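(* Let $\mathcal{H}$ be a complex Hilbert space and let $\mathbf{T}=(T_1,T_2)$ be a commuting pair of bounded linear operators on $\mathcal{H}$ which is a left-inverse commuting toral $2$-isometry satisfying $T_i^*T_i(\ker T_i^* )\subseteq\ker T_i^*$ for $i=1,2$. If $|T_1|\,|T_2|f=|T_2|\,|T_1|f$ for all $f\in\ker\mathbf{T}^*:=\ker T_1^*\cap\ker T_2^*$, then the toral Cauchy dual $\mathbf{T}'=(T_1',T_2')$ is a commuting pair of contractions that is jointly subnormal.
   Context: $B(\mathcal{H})$ is the algebra of bounded linear operators on $\mathcal{H}$, and $|T|:=(T^*T)^{1/2}$. An operator $T\in B(\mathcal{H})$ is left-invertible if $T^*T$ is invertible; its Cauchy dual is then $T':=T(T^*T)^{-1}$. The toral Cauchy dual of a pair $(T_1,T_2)$ of left-invertible operators is $(T_1',T_2')$. A commuting pair $(T_1,T_2)$ is a toral $2$-isometry if $I-T_i^*T_i-T_j^*T_j+T_j^*T_i^*T_iT_j=0$ for all $i,j\in\{1,2\}$ (including $i=j$). In this case each $T_i$ is left-invertible. A commuting pair $(T_1,T_2)$ of left-invertible operators is left-inverse commuting if $L_iT_j=T_jL_i$ for $1\le i\ne j\le 2$, where $L_j:=(T_j^*T_j)^{-1}T_j^*$. A commuting pair $(S_1,S_2)$ on $\mathcal{H}$ is jointly subnormal if there are a Hilbert space $\mathcal{K}\supseteq\mathcal{H}$ and commuting normal operators $N_1,N_2\in B(\mathcal{K})$ such that $\mathcal{H}$ is invariant under each $N_j$ and $S_j=N_j|_{\mathcal{H}}$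 for $j=1,2$. *)

(* Defs.v *)
From HB Require Import structures.
From mathcomp Require Import all_boot all_order all_algebra.
From mathcomp Require Import complex.
From mathcomp Require Import all_classical all_reals.
From mathcomp Require Import topology normedtype.

Set Implicit Arguments.
Unset Strict Implicit.
Unset Printing Implicit Defensive.

Import Order.TTheory GRing.Theory Num.Theory Num.Def.
Import numFieldTopology.Exports numFieldNormedType.Exports.

Local Open Scope classical_set_scope.
Local Open Scope ring_scope.

(* [{dot V for conjC}] is the library's type of positive definite Hermitian
   forms, linear in the first argument and conjugate-linear in the second. *)
HB.mixin Record CompleteNormedModule_isHilbert (R : realType) V
    & CompleteNormedModule R[i] V := {
  dot : {dot V for conjC};
  dotE : forall x : V, dot x x = `|x| ^+ 2
}.

#[short(type="hilbertType")]
HB.structure Definition Hilbert (R : realType) :=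
  {V of CompleteNormedModule_isHilbert R V & CompleteNormedModule R[i] V}.

Record bop (R : realType) (H : hilbertType R) := BOp {
  bop_fun :> {linear H -> H};
  bop_continuous : continuous bop_fun
}.

Notation "''B' ( H )" := (bop H) (format "''B' ( H )") : type_scope.

HB.instance Definition _ (R : realType) (H : hilbertType R) :=
  gen_eqMixin 'B(H).
HB.instance Definition _ (R : realType) (H : hilbertType R) :=
  gen_choiceMixin 'B(H).

Section BoundedOperatorRing.
Context {R : realType} {H : hilbertType R}.
Implicit Types A B C : 'B(H).

Lemma bopP A B : A =1 B -> A = B.
Proof.
case: A B => [f cf] [g cg] /= fg.
suff e : f = g by case: _ / e cg {fg} => cg; rewrite (Prop_irrelevance cf cg).
case: f g {cf cg} fg => f Lf [g Lg] /= /funext fg.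
case: _ / fg Lg => Lg; congr GRing.Linear.Pack.
case: Lf Lg => [[f1] [f2]] [[g1] [g2]].
by rewrite (Prop_irrelevance f1 g1) (Prop_irrelevance f2 g2).
Qed.

Definition bop0 : 'B(H) := @BOp R H \0 (fun=> cvg_cst _).

Definition bop1 : 'B(H) := @BOp R H idfun (fun=> cvg_id).

Definition bopN A : 'B(H) :=
  @BOp R H (\- A) (fun x => cvgN (@bop_continuous _ _ A x)).

Definition bopD A B : 'B(H) := @BOp R H (A \+ B)
  (fun x => cvgD (@bop_continuous _ _ A x) (@bop_continuous _ _ B x)).

Definition bopM A B : 'B(H) := @BOp R H (A \o B)
  (fun x => continuous_comp (@bop_continuous _ _ B x) (@bop_continuous _ _ A _)).

Lemma bopDA : associative bopD.
Proof. by move=> A B C; apply: bopP => x /=; rewrite addrA. Qed.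
Lemma bopDC : commutative bopD.
Proof. by move=> A B; apply: bopP => x /=; rewrite addrC. Qed.
Lemma bop0D : left_id bop0 bopD.
Proof. by move=> A; apply: bopP => x /=; rewrite add0r. Qed.
Lemma bopND : left_inverse bop0 bopN bopD.
Proof. by move=> A; apply: bopP => x /=; rewrite addNr. Qed.

HB.instance Definition _ := GRing.isZmodule.Build 'B(H) bopDA bopDC bop0D bopND.

Lemma bopMA : associative bopM.
Proof. by move=> A B C; apply: bopP. Qed.
Lemma bop1M : left_id bop1 bopM.
Proof. by move=> A; apply: bopP. Qed.
Lemma bopM1 : right_id bop1 bopM.
Proof. by move=> A; apply: bopP. Qed.
Lemma bopMDl : left_distributive bopM bopD.
Proof. by move=> A B C; apply: bopP. Qed.
Lemma bopMDr : right_distributive bopM bopD.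
Proof. by move=> A B C; apply: bopP => x /=; rewrite raddfD. Qed.

HB.instance Definition _ :=
  GRing.Zmodule_isPzRing.Build 'B(H) bopMA bop1M bopM1 bopMDl bopMDr.

End BoundedOperatorRing.

Section Operators.
Context {R : realType} {H : hilbertType R}.
Implicit Types A B T : 'B(H).

(* The characterizing property determines at most one operator, and some
   operator satisfies it by the Riesz representation theorem. *)
Definition adj T : 'B(H) :=
  xget 0 [set A : 'B(H) | forall x y, dot (T x) y = dot x (A y)].

Definition invertible_op T := exists A : 'B(H), A * T = 1 /\ T * A = 1.

(* [0] if [T] is not invertible *)
Definition inv_op T : 'B(H) := xget 0 [set A : 'B(H) | A * T = 1 /\ T * A = 1].

(* In [R[i]], [0 <= z] means that [z] is real and nonnegative. *)
Definition positive_op T := forall x, 0 <= dot (T x) x.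

(* The positive square root of a positive operator exists and is unique. *)
Definition sqrt_op T : 'B(H) :=
  xget 0 [set A : 'B(H) | positive_op A /\ A * A = T].

Definition modulus T : 'B(H) := sqrt_op (adj T * T).

Definition normal_op T := adj T * T = T * adj T.

Definition contractive_op T := forall x, `|T x| <= `|x|.

Definition ker_op T : set H := [set x | T x = 0].

Definition left_invertible T := invertible_op (adj T * T).

Definition cauchy_dual T : 'B(H) := T * inv_op (adj T * T).

Definition left_inv_op T : 'B(H) := inv_op (adj T * T) * adj T.

End Operators.

Section Pairs.
Context {R : realType} {H : hilbertType R}.
Implicit Types S T : 'I_2 -> 'B(H).

Definition commuting_pair T := T ord0 * T ord_max = T ord_max * T ord0.

Definition toral_2_isometry T := commuting_pair T /\
  forall i j, 1 - adj (T i) * T i - adj (T j) * T j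
              + adj (T j) * adj (T i) * T i * T j = 0.

Definition left_inverse_commuting T :=
  [/\ commuting_pair T,
      forall i, left_invertible (T i) &
      forall i j, i != j -> left_inv_op (T i) * T j = T j * left_inv_op (T i)].

Definition toral_cauchy_dual T : 'I_2 -> 'B(H) := fun i => cauchy_dual (T i).

(* The inclusion of [H] in [K] is encoded by a linear isometry [V : H -> K];
   [V (S j x) = N j (V x)] says that the range of [V] is invariant under [N j]
   and that [N j] restricts to [S j] on it. *)
Definition jointly_subnormal S := commuting_pair S /\
  exists (K : hilbertType R) (V : {linear H -> K}) (N : 'I_2 -> 'B(K)),
    [/\ forall x y, dot (V x) (V y) = dot x y,
        N ord0 * N ord_max = N ord_max * N ord0,
        forall j, normal_op (N j) &
        forall j x, V (S j x) = N j (V x)].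

End Pairs.

(* Main.v *)
Require Import Defs.
From HB Require Import structures.
From mathcomp Require Import all_boot all_order all_algebra.
From mathcomp Require Import complex.
From mathcomp Require Import all_classical all_reals.
From mathcomp Require Import topology normedtype sequences.
From mathcomp Require Import ring lra.

(** Write Q_i for the Gram operator (adj T_i) T_i, B_i for Q_i - 1 and
    S_i = T_i Q_i^-1 for the Cauchy dual.

    Algebra.  The kernel condition says that Q_i respects the orthogonal
    splitting of the space into ran T_i and ker (adj T_i), and left-inverse
    commutation gives the same for Q_j with the other index j.  Both sides of
    B_j T_i = S_i B_j therefore have range in ran T_i, and there the identity
    can be checked after applying adj T_i, where it is the toral identity
    ([defectT]).  It follows that the operators c(n,m) = 1 + n B_1 + m B_2
    satisfy S_1 c(n+1,m) = c(n,m) T_1 ([dual_weight]), and by iteration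
    S^(n,m) c(n,m) = T^(n,m); since S_i and adj T_i are one-sided inverses,
    c(n,m) is the Gram operator of T^(n,m) and its inverse is the Gram
    operator of S^(n,m).  That S_1 and S_2 commute drops out.  The identity
    |T_i^n x|^2 = |x|^2 + n <B_i x, x> for all n forces B_i >= 0, which makes
    S_i a contraction ([defect_ge0], [rnorm_dual]).

    B_1 and B_2 commute ([defect_commute]).  The moduli leave the joint kernel
    of adj T_1 and adj T_2 invariant, so that their squares Q_1 and Q_2 commute
    on it as they do.  Multiplication by T_i transports the commutator of B_1
    and B_2 from one level of the Wold decomposition of T_i to the next one,
    and n [B_1, B_2] T_i^n stays bounded in n, which takes care of the part
    that no level reaches ([commutator_vanish]).

    Positivity ([bram_psd]).  By the Bram-Halmos criterion it is enough that
    the sum of <S^p h_q, S^q h_p> over finitely many multi-indices p and q is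
    nonnegative.  When h_q = S^q v_q, the sum is that of <c(p+q)^-1 v_q, v_p>,
    a Cauchy kernel 1/(x_p + x_q) in the commuting positive operators
    x_p = c(2p)/2, and Cauchy kernels are positive semidefinite
    ([cauchy_psd]).  A general family h is reduced to this form one variable
    at a time, by splitting h_q along ran S_i^n and ker (adj T_i)^n
    ([split_form_ge0]).

    Dilation ([Bram_Halmos]).  The positive form is an inner product on the
    finitely supported functions on pairs of indices with values in H; h stands
    for the sum of (adj N)^q h_q.  In the completion, the action of S_j on the
    values of h extends to an operator N_j whose adjoint shifts the index.  It
    is bounded because |N_j^n h|^2 is a convex and bounded function of n, hence
    nonincreasing ([power_bounded_contraction]).

    The moduli and adjoints of the statement are selected by description, so
    their existence is established first: adjoints by the Riesz theorem
    ([Riesz], [adj_exists]), moduli by a contraction argument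
    ([sqrt_exists]). *)

Set Implicit Arguments.
Unset Strict Implicit.
Unset Printing Implicit Defensive.

Import Order.TTheory GRing.Theory Num.Theory Num.Def.
Import numFieldTopology.Exports numFieldNormedType.Exports.

Local Open Scope classical_set_scope.
Local Open Scope ring_scope.

Local Notation Rez := (@complex.Re _).
Local Notation Imz := (@complex.Im _).
Local Notation toC := (real_complex _).

(** * Real norms, limits and Cauchy sequences *)

Section RealNorm.
Context {R : realType} {V : normedZmodType R[i]}.
Implicit Types x y : V.

(** The norm of a module over [R[i]] takes its values in [R[i]]; its real part
    is used instead so that inequalities can be handled in an ordered field. *)
Definition rnorm x : R := Rez `|x|.

Lemma rnormE x : `|x| = toC (rnorm x).
Proof. by rewrite /rnorm RRe_real // normr_real. Qed.
Lemma rnorm_ge0 x : 0 <= rnorm x.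
Proof. by rewrite -lecR -rnormE normr_ge0. Qed.
Lemma rnorm0 : rnorm 0 = 0.
Proof. by rewrite /rnorm normr0. Qed.
Lemma rnormN x : rnorm (- x) = rnorm x.
Proof. by rewrite /rnorm normrN. Qed.
Lemma rnormC x y : rnorm (x - y) = rnorm (y - x).
Proof. by rewrite -rnormN opprB. Qed.
Lemma rnormD x y : rnorm (x + y) <= rnorm x + rnorm y.
Proof. by rewrite -lecR rmorphD /= -!rnormE ler_normD. Qed.
Lemma rnorm_tri z x y : rnorm (x - y) <= rnorm (x - z) + rnorm (z - y).
Proof. by rewrite -[x - y](subrKA z); apply: rnormD. Qed.
Lemma rnorm0_eq0 x : rnorm x = 0 -> x = 0.
Proof. by move=> x0; apply/normr0_eq0; rewrite rnormE x0. Qed.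

Definition tends (u : nat -> V) l :=
  forall e : R, 0 < e -> exists N, forall n, (N <= n)%N -> rnorm (u n - l) < e.
Definition Cauchy (u : nat -> V) :=
  forall e : R, 0 < e -> exists N, forall m n, (N <= m)%N -> (N <= n)%N ->
    rnorm (u m - u n) < e.

Lemma rnorm_small x : (forall e : R, 0 < e -> rnorm x < e) -> x = 0.
Proof.
move=> xe; apply: rnorm0_eq0; apply/eqP; rewrite eq_le rnorm_ge0 andbT leNgt.
by apply/negP => x0; have := xe _ x0; rewrite ltxx.
Qed.

Lemma tends_cst x : tends (fun=> x) x.
Proof. by move=> e e0; exists 0%N => n _; rewrite subrr rnorm0. Qed.

Lemma tendsB u v l m : tends u l -> tends v m -> tends (fun n => u n - v n) (l - m).
Proof.
move=> ul vm e e0; have e2 : 0 < e / 2 by lra.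
have [N1 h1] := ul _ e2; have [N2 h2] := vm _ e2.
exists (maxn N1 N2) => n; rewrite geq_max => /andP[/h1 a /h2 b].
have -> : u n - v n - (l - m) = (u n - l) - (v n - m).
  by rewrite !opprB addrACA [RHS]addrACA; congr (_ + _); rewrite addrC.
by have := rnormD (u n - l) (- (v n - m)); rewrite rnormN; lra.
Qed.

Lemma tendsN u l : tends u l -> tends (fun n => - u n) (- l).
Proof.
by move=> ul; have := tendsB (tends_cst 0) ul; rewrite sub0r; under eq_fun do rewrite sub0r.
Qed.
Lemma tendsD u v l m : tends u l -> tends v m -> tends (fun n => u n + v n) (l + m).
Proof.
move=> ul /tendsN vm; have := tendsB ul vm; rewrite opprK.
by under eq_fun do rewrite opprK.
Qed.

Lemma tends_uniq u l m : tends u l -> tends u m -> l = m.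
Proof.
move=> ul um; have h := tendsB ul um; apply/eqP; rewrite -subr_eq0; apply/eqP.
apply: rnorm_small => e /h[N /(_ N (leqnn N))]; by rewrite subrr sub0r rnormN.
Qed.

End RealNorm.

Section ComplexFacts.
Context {R : realType}.
Implicit Types (z w : R[i]).

Lemma ge0_toC z : 0 <= z -> z = toC (Rez z).
Proof. by move=> z0; rewrite RRe_real // ger0_real. Qed.

Lemma rnormM z w : rnorm (z * w) = rnorm z * rnorm w.
Proof. by apply: complexI; rewrite -rnormE normrM !rnormE rmorphM. Qed.

Lemma Re_le_rnorm z : `|Rez z| <= rnorm z.
Proof. by rewrite -lecR -rnormE normc_ge_Re. Qed.

Lemma Cauchy_real (a : nat -> R) :
  (forall e : R, 0 < e -> exists N, forall m n, (N <= m)%N -> (N <= n)%N ->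
    `|a m - a n| < e) ->
  exists l, forall e : R, 0 < e -> exists N, forall n, (N <= n)%N ->
    `|a n - l| < e.
Proof.
move=> ca; have : cvg (a @ \oo).
  apply: cauchy_cvg; apply/cauchy_exP => e e0; have [N h] := ca _ e0.
  by exists (a N); exists N => // n /= Nn; apply: h.
move=> /cvg_ex[l al]; exists l => e e0.
have /cvgrPdist_lt/(_ _ e0)[N _ h] := al.
by exists N => n Nn; rewrite distrC; apply: h.
Qed.

Lemma rnorm_real (r : R) : rnorm (toC r) = `|r|.
Proof. by rewrite /rnorm normc_def /= expr0n /= addr0 sqrtr_sqr. Qed.

Lemma rnorm_le_ReIm z : rnorm z <= `|Rez z| + `|Imz z|.
Proof.
have {1}-> : z = toC (Rez z) + 'i%C * toC (Imz z) by apply: complexE.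
apply: (le_trans (rnormD _ _)).
rewrite rnormM [rnorm 'i%C]/rnorm normc_def /= expr0n /= expr1n add0r sqrtr1 mul1r.
by rewrite !rnorm_real.
Qed.

Lemma Im_le_rnorm z : `|Imz z| <= rnorm z.
Proof.
rewrite -lecR -rnormE normc_def lecR -sqrtr_sqr ler_wsqrtr //.
by rewrite lerDr sqr_ge0.
Qed.

Lemma Cauchy_complex (u : nat -> R[i]) : Cauchy u -> exists l, tends u l.
Proof.
move=> cu.
have [e e0|a ha] := @Cauchy_real (fun n => Rez (u n)).
  have [N h] := cu _ e0; exists N => m n Nm Nn; apply: le_lt_trans (h _ _ Nm Nn).
  by rewrite (le_trans _ (Re_le_rnorm _)) // [in leRHS]raddfB.
have [e e0|b hb] := @Cauchy_real (fun n => Imz (u n)).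
  have [N h] := cu _ e0; exists N => m n Nm Nn; apply: le_lt_trans (h _ _ Nm Nn).
  by rewrite (le_trans _ (Im_le_rnorm _)) // [in leRHS]raddfB.
exists (Complex a b) => e e0; have e2 : 0 < e / 2 by lra.
have [N1 h1] := ha _ e2; have [N2 h2] := hb _ e2.
exists (maxn N1 N2) => n; rewrite geq_max => /andP[/h1 r1 /h2 r2].
apply: (le_lt_trans (rnorm_le_ReIm _)); rewrite !raddfB /=.
by apply: lt_le_trans (ltrD r1 r2) _; lra.
Qed.
End ComplexFacts.

Lemma Cauchy_complete {R : realType} {V : completeNormedModType R[i]}
  (u : nat -> V) : Cauchy u -> exists l, tends u l.
Proof.
move=> cu; have : cvg (u @ \oo).
  apply: cauchy_cvg; apply/cauchy_exP => e e0.
  have e0' : 0 < Rez e by rewrite -ltcR -(ge0_toC (ltW e0)).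
  have [N h] := cu _ e0'.
  exists (u N); exists N => // n /= Nn.
  rewrite -ball_normE /= rnormE (ge0_toC (ltW e0)) ltcR.
  by apply: h.
move=> /cvg_ex[l al]; exists l => e e0.
have e0' : 0 < toC e by rewrite ltcR.
have /cvgrPdist_lt/(_ _ e0')[N _ h] := al.
by exists N => n Nn; rewrite rnormC -ltcR -rnormE; apply: h.
Qed.

(** A discriminant bound.  For [Y > 0] the quadratic is minimal at [Y^-1]; for
    [Y = 0] it is affine and negative at the witness of the proof. *)
Lemma discr_le {R : realFieldType} (X Y W : R) : 0 <= X -> 0 <= Y -> 0 <= W ->
  (forall s, 0 <= X - 2 * s * W + s ^+ 2 * W * Y) -> W <= X * Y.
Proof.
move=> X0 Y0; rewrite le_eqVlt => /predU1P[<- _|W0 h]; first exact: mulr_ge0.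
move: Y0; rewrite le_eqVlt => /predU1P[Y0|Y0].
  have := h ((X + 1) / (2 * W)); rewrite -Y0.
  have -> : X - 2 * ((X + 1) / (2 * W)) * W +
   ((X + 1) / (2 * W)) ^+ 2 * W * 0 = -1 by field; lra.
  by lra.
have := h Y^-1.
have -> : X - 2 * Y^-1 * W + Y^-1 ^+ 2 * W * Y = (X * Y - W) / Y by field; lra.
by rewrite ler_pdivlMr // mul0r subr_ge0.
Qed.

(** * Positive semidefinite Hermitian forms *)

Section SemiInner.
Context {R : realType} {U : lmodType R[i]}.
Variable (f : {hermitian U for false & conjC}).
Hypothesis f_ge0 : forall x, 0 <= f x x.

Lemma formC x y : f y x = conjC (f x y).
Proof. by rewrite [LHS]hermitian_subproof /= expr0 mul1r. Qed.

Definition sqnorm x : R := Rez (f x x).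
Definition seminorm x : R := Num.sqrt (sqnorm x).

Lemma sqnormE x : f x x = toC (sqnorm x).
Proof. by rewrite -ge0_toC. Qed.
Lemma sqnorm_ge0 x : 0 <= sqnorm x.
Proof. by rewrite -lecR -sqnormE f_ge0. Qed.
Lemma seminorm_ge0 x : 0 <= seminorm x.
Proof. exact: sqrtr_ge0. Qed.
Lemma seminorm_sqr x : seminorm x ^+ 2 = sqnorm x.
Proof. by rewrite sqr_sqrtr // sqnorm_ge0. Qed.

Lemma sqnormD x y : sqnorm (x + y) = sqnorm x + sqnorm y + 2 * Rez (f x y).
Proof.
rewrite /sqnorm linearDl !linearDr /= (formC x y).
have -> : Rez (f x x + f x y + (conjC (f x y) + f y y)) =
  Rez (f x x) + Rez (f x y) + (Rez (conjC (f x y)) + Rez (f y y)).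
  by rewrite !raddfD.
have -> : Rez (conjC (f x y)) = Rez (f x y) by case: (f x y).
by lra.
Qed.

Lemma sqnormZ a x : sqnorm (a *: x) = rnorm a ^+ 2 * sqnorm x.
Proof.
apply: complexI; rewrite -sqnormE linearZl_LR linearZr_LR /= mulrA -normCK rnormE.
by rewrite sqnormE rmorphM /= rmorphXn.
Qed.

Lemma sqnormN x : sqnorm (- x) = sqnorm x.
Proof. by rewrite /sqnorm linearNl linearNr opprK. Qed.

Lemma sqnormB x y : sqnorm (x - y) = sqnorm x + sqnorm y - 2 * Rez (f x y).
Proof. by rewrite sqnormD sqnormN linearNr raddfN /=; lra. Qed.

(** Expand the nonnegative square of [x - (s * f x y) *: y] for real [s]. *)
Lemma form_CS2 x y : rnorm (f x y) ^+ 2 <= sqnorm x * sqnorm y.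
Proof.
apply: discr_le (sqnorm_ge0 _) (sqnorm_ge0 _) (sqr_ge0 _) _ => s.
have := sqnorm_ge0 (x - (toC s * f x y) *: y).
rewrite sqnormB sqnormZ linearZr_LR /=.
have -> : conjC (toC s * f x y) * f x y = toC (s * rnorm (f x y) ^+ 2).
  rewrite rmorphM -mulrA [X in _ * X = _]mulrC -normCK rnormE -rmorphXn [RHS]rmorphM.
  congr (_ * _); apply: conj_Creal; apply/complex_realP; by exists s.
rewrite rnormM exprMn /=.
have -> : rnorm (toC s) ^+ 2 = s ^+ 2.
  by rewrite rnorm_real real_normK ?num_real.
by lra.
Qed.

Lemma form_CS x y : rnorm (f x y) <= seminorm x * seminorm y.
Proof.
rewrite -(@ler_pXn2r _ 2) ?nnegrE ?rnorm_ge0 ?mulr_ge0 ?seminorm_ge0 //.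
by rewrite exprMn !seminorm_sqr form_CS2.
Qed.

Lemma seminormD x y : seminorm (x + y) <= seminorm x + seminorm y.
Proof.
rewrite -(@ler_pXn2r _ 2) ?nnegrE ?addr_ge0 ?seminorm_ge0 //.
rewrite seminorm_sqr sqnormD sqrrD !seminorm_sqr.
have := form_CS x y; have := Re_le_rnorm (f x y); have := ler_norm (Rez (f x y)).
by lra.
Qed.

Lemma seminormZ a x : seminorm (a *: x) = rnorm a * seminorm x.
Proof. by rewrite /seminorm sqnormZ sqrtrM ?sqr_ge0 // sqrtr_sqr ger0_norm ?rnorm_ge0. Qed.
Lemma parallelogram x y : sqnorm (x + y) + sqnorm (x - y) = 2 * (sqnorm x + sqnorm y).
Proof. by rewrite sqnormB sqnormD; lra. Qed.
End SemiInner.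

Lemma inv_nat_small {R : realType} (e : R) : 0 < e ->
  exists N, forall n, (N <= n)%N -> n.+1%:R^-1 < e.
Proof.
move=> e0; exists (Num.bound e^-1) => n Nn.
rewrite invf_plt ?posrE ?ltr0Sn //.
apply: lt_le_trans (archi_boundP _) _; first by rewrite invr_ge0 ltW.
by rewrite ler_nat (leq_trans Nn).
Qed.

Section ReFacts.
Context {R : realType}.
Implicit Types z w : R[i].
Lemma ReD z w : Rez (z + w) = Rez z + Rez w. Proof. by case: z w => a b [c d]. Qed.
Lemma ReB z w : Rez (z - w) = Rez z - Rez w. Proof. by case: z w => a b [c d]. Qed.
Lemma ReJ z : Rez (conjC z) = Rez z. Proof. by case: z. Qed.
Lemma ReM (r : R) z : Rez (toC r * z) = r * Rez z.
Proof. by case: z => c d /=; rewrite mul0r subr0. Qed.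
End ReFacts.

Lemma conjCB {R : realType} (a b : R[i]) : conjC (a - b) = conjC a - conjC b.
Proof. exact: rmorphB. Qed.
Lemma rnormJ {R : realType} (a : R[i]) : rnorm (conjC a) = rnorm a.
Proof. by rewrite /rnorm norm_conjC. Qed.

(** * Hilbert spaces and the Riesz theorem *)

Section Hilbert.
Context {R : realType} {H : hilbertType R}.
Implicit Types (x y z : H) (A B T : 'B(H)).

(** The form [dot] is a bundled structure; a plain function of two vectors is
    easier to rewrite with. *)
Definition ip x y : R[i] := dot x y.

Lemma dot_ge0 x : 0 <= dot x x.
Proof. by rewrite dotE exprn_ge0. Qed.

Lemma sqnorm_dot x : sqnorm dot x = rnorm x ^+ 2.
Proof. apply: complexI; rewrite rmorphXn /= -rnormE -dotE; exact/esym/(sqnormE dot_ge0). Qed.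

Lemma seminorm_dot x : seminorm dot x = rnorm x.
Proof. by rewrite /seminorm sqnorm_dot sqrtr_sqr ger0_norm ?rnorm_ge0. Qed.

Lemma ipC x y : ip y x = conjC (ip x y).
Proof. exact: (formC dot). Qed.

Lemma ipDl x y z : ip (x + y) z = ip x z + ip y z.
Proof. exact: linearDl. Qed.
Lemma ipDr x y z : ip x (y + z) = ip x y + ip x z.
Proof. exact: linearDr. Qed.
Lemma ipNl x z : ip (- x) z = - ip x z.
Proof. exact: linearNl. Qed.
Lemma ipNr x z : ip x (- z) = - ip x z.
Proof. exact: linearNr. Qed.
Lemma ipBl x y z : ip (x - y) z = ip x z - ip y z.
Proof. exact: linearBl. Qed.
Lemma ipBr x y z : ip x (y - z) = ip x y - ip x z.
Proof. exact: linearBr. Qed.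
Lemma ipZl a x z : ip (a *: x) z = a * ip x z.
Proof. by rewrite /ip linearZl_LR. Qed.
Lemma ipZr a x z : ip x (a *: z) = conjC a * ip x z.
Proof. by rewrite /ip linearZr_LR. Qed.
Lemma ip0l z : ip (0 : H) z = 0.
Proof. exact: linear0l. Qed.
Lemma ip0r z : ip z (0 : H) = 0.
Proof. exact: linear0r. Qed.

Lemma ip_sq x : ip x x = toC (rnorm x ^+ 2).
Proof. by rewrite /ip dotE rnormE rmorphXn. Qed.

Lemma ip_CS x y : rnorm (ip x y) <= rnorm x * rnorm y.
Proof. by rewrite -!seminorm_dot (form_CS dot_ge0). Qed.

Lemma ip_eq0 x : ip x x = 0 -> x = 0.
Proof. by rewrite /ip dotE => /eqP; rewrite expf_eq0 normr_eq0 => /eqP. Qed.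

Lemma ip_inj x y : (forall z, ip z x = ip z y) -> x = y.
Proof.
move=> h; apply/eqP; rewrite -subr_eq0; apply/eqP/ip_eq0.
by rewrite ipBr h subrr.
Qed.

Lemma rnormZ a x : rnorm (a *: x) = rnorm a * rnorm x.
Proof. by apply: complexI; rewrite -rnormE normrZ !rnormE rmorphM. Qed.

Lemma tends_ip u x z : tends u x -> tends (fun n => ip (u n) z) (ip x z).
Proof.
move=> ux e e0; have k0 : 0 < rnorm z + 1 by have := rnorm_ge0 z; lra.
have [N h] := ux _ (divr_gt0 e0 k0); exists N => n /h; rewrite -ipBl => h1.
apply: le_lt_trans (ip_CS _ _) _.
rewrite ltr_pdivlMr // in h1; apply: le_lt_trans h1.
by rewrite ler_wpM2l ?rnorm_ge0 // lerDl.
Qed.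

Lemma rnormD2 x y : rnorm (x + y) ^+ 2 = rnorm x ^+ 2 + rnorm y ^+ 2 + 2 * Rez (ip x y).
Proof. by rewrite -!sqnorm_dot (sqnormD dot). Qed.
Lemma rnormB2 x y : rnorm (x - y) ^+ 2 = rnorm x ^+ 2 + rnorm y ^+ 2 - 2 * Rez (ip x y).
Proof. by rewrite -!sqnorm_dot (sqnormB dot). Qed.

Section Riesz.
Variables (phi : H -> R[i]) (M : R).
Hypothesis phiD : forall x y, phi (x + y) = phi x + phi y.
Hypothesis phiZ : forall a x, phi (a *: x) = a * phi x.
Hypothesis phiM : forall x, rnorm (phi x) <= M * rnorm x.

Let J x := rnorm x ^+ 2 - 2 * Rez (phi x).

Let J_ge x : - M ^+ 2 <= J x.
Proof.
have := Re_le_rnorm (phi x); have := ler_norm (Rez (phi x)); have := phiM x.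
by have := sqr_ge0 (rnorm x - M); rewrite /J; nra.
Qed.

Let Jinf := inf (range J).

Let Jinf_le x : Jinf <= J x.
Proof.
apply: ge_inf; last by exists x.
by exists (- M ^+ 2) => _ [y _ <-].
Qed.

Let min_seq n : exists x, J x < Jinf + n.+1%:R^-1.
Proof.
have [_ [x _ <-] h] : exists2 y, range J y & y < Jinf + n.+1%:R^-1.
  apply: inf_adherent; first by rewrite invr_gt0 ltr0Sn.
  split; first by exists (J 0); exists 0.
  by exists (- M ^+ 2) => _ [y _ <-].
by exists x.
Qed.

(** The midpoint of [x] and [y] cannot do better than the infimum. *)
Let min_gap x y : rnorm (x - y) ^+ 2 <= 2 * (J x - Jinf) + 2 * (J y - Jinf).
Proof.
have := Jinf_le (toC (2^-1) *: (x + y)).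
have -> : J (toC (2^-1) *: (x + y)) =
    rnorm (x + y) ^+ 2 / 4 - (Rez (phi x) + Rez (phi y)).
  rewrite /J rnormZ rnorm_real phiZ phiD exprMn real_normK ?num_real //.
  have -> : Rez (toC (2^-1) * (phi x + phi y)) = 2^-1 * (Rez (phi x) + Rez (phi y)).
    by rewrite ReM ReD.
  by field.
have := parallelogram dot x y; rewrite !sqnorm_dot /J.
by lra.
Qed.

(** [J] drops by at most [J x - Jinf] along the line through [x] with direction
    [h], which bounds its slope at [x]. *)
Let variation x h : Rez (ip h x - phi h) ^+ 2 <= (J x - Jinf) * rnorm h ^+ 2.
Proof.
apply: discr_le; rewrite ?sqr_ge0 ?subr_ge0 //.
move=> s; set b := Rez (ip h x - phi h); have := Jinf_le (x - toC (s * b) *: h).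
have -> : J (x - toC (s * b) *: h) =
    J x + (s * b) ^+ 2 * rnorm h ^+ 2 - 2 * (s * b) * b.
  rewrite /J rnormB2 rnormZ exprMn rnorm_real real_normK ?num_real //.
  have -> : phi (x - toC (s * b) *: h) = phi x - toC (s * b) * phi h.
    by rewrite -scaleNr phiD phiZ mulNr.
  have bE : b = Rez (ip h x) - Rez (phi h) by rewrite /b ReB.
  by rewrite ipC ipZl ReJ ReB !ReM bE; ring.
by lra.
Qed.

(** The representing vector minimizes [J x = |x|^2 - 2 Re (phi x)].  Near the
    infimum the parallelogram law makes minimizing sequences Cauchy
    ([min_gap]), and the derivative of [J] in every direction is small
    ([variation]). *)
Lemma Riesz : exists z, forall x, phi x = ip x z.
Proof.
have /boolp.choice[u hu] := min_seq.
have [e e0|z uz] := @Cauchy_complete _ H u.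
  have e4 : 0 < e ^+ 2 / 4 by rewrite divr_gt0 ?exprn_gt0.
  have [N h] := inv_nat_small e4; exists N => m n /h hm /h hn.
  rewrite -(@ltr_pXn2r _ 2) ?nnegrE ?rnorm_ge0 ?(ltW e0) //.
  move: hm hn (min_gap (u m) (u n)) (hu m) (hu n).
  move: m.+1%:R^-1 n.+1%:R^-1 (J (u m)) (J (u n)) Jinf => a b c d i ? ? ? ? ?.
  lra.
have ReZ x : Rez (ip x z - phi x) = 0.
  apply/eqP; rewrite -normr_le0; apply/ler_addgt0Pr => e e0; rewrite add0r.
  have k0 : 0 < rnorm x ^+ 2 + 1 by have := sqr_ge0 (rnorm x); lra.
  have e2 : 0 < (e / 2) ^+ 2 / (rnorm x ^+ 2 + 1) by rewrite divr_gt0 ?exprn_gt0 ?divr_gt0.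
  have [N1 h1] := inv_nat_small e2.
  have l0 : 0 < e / 2 / (rnorm x + 1) by rewrite !divr_gt0 //; have := rnorm_ge0 x; lra.
  have [N2 h2] := uz _ l0.
  set n := maxn N1 N2.
  have {}h1 := h1 n (leq_maxl _ _); have {}h2 := h2 n (leq_maxr _ _).
  have -> : ip x z - phi x = (ip x (u n) - phi x) - ip x (u n - z).
    by rewrite ipBr; ring.
  rewrite ReB; apply: le_trans (ler_normB _ _) _.
  have : `|Rez (ip x (u n) - phi x)| <= e / 2.
    rewrite -(@ler_pXn2r _ 2) ?nnegrE ?(ltW (divr_gt0 _ _)) // real_normK ?num_real //.
    apply: le_trans (variation _ _) _.
    rewrite ltr_pdivlMr // in h1; apply: ltW; apply: le_lt_trans h1.
    have := hu n; have := sqr_ge0 (rnorm x); set v := _^-1; set w := _ ^+ 2.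
    have : 0 < v by rewrite invr_gt0 ltr0Sn.
    by nra.
  have : rnorm (ip x (u n - z)) <= e / 2.
    apply: le_trans (ip_CS _ _) _.
    rewrite ltr_pdivlMr in h2; last by have := rnorm_ge0 x; lra.
    by have := rnorm_ge0 x; have := rnorm_ge0 (u n - z); nra.
  have := Re_le_rnorm (ip x (u n - z)).
  by lra.
exists z => x; apply/eqP; rewrite eq_sym -subr_eq0; apply/eqP.
(* The imaginary part of a linear form at [x] is minus its real part at [i x]. *)
have := ReZ ('i%C *: x); rewrite ipZl phiZ -mulrBr.
move: (ReZ x); case: (_ - _) => a b /= ->.
by rewrite mul0r mul1r sub0r => /eqP; rewrite oppr_eq0 => /eqP ->.
Qed.
End Riesz.
End Hilbert.

(** * Adjoints *)

Section BoundedLinear.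
Context {R : realType} {V W : normedModType R[i]}.

Lemma linear_bounded_ex (f : {linear V -> W}) : continuous f ->
  exists2 M : R, 0 <= M & forall x, rnorm (f x) <= M * rnorm x.
Proof.
move=> /linear_bounded_continuous/linear_boundedP/pinfty_ex_gt0[M M0 hM].
exists (Rez M); first by rewrite -lecR -(ge0_toC (ltW M0)) ltW.
by move=> x; rewrite -lecR rmorphM /= -(ge0_toC (ltW M0)) -!rnormE.
Qed.

Lemma bounded_linear_cont (f : {linear V -> W}) (M : R) :
  (forall x, rnorm (f x) <= M * rnorm x) -> continuous f.
Proof.
move=> hM; apply/linear_bounded_continuous/linear_boundedP.
exists (toC M); split; first by apply/complex_realP; exists M.
move=> r Mr x; apply: le_trans (_ : toC M * `|x| <= _).
  by rewrite !rnormE -rmorphM lecR.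
by rewrite ler_wpM2r // ltW.
Qed.
End BoundedLinear.

Section MkBop.
Context {R : realType} {H : hilbertType R}.
Variables (f : H -> H) (M : R).
Hypothesis fL : linear f.
Hypothesis fM : forall x, rnorm (f x) <= M * rnorm x.

Lemma mk_bop : exists A : 'B(H), forall x, A x = f x.
Proof.
pose mx := GRing.isLinear.Build _ _ _ _ f fL.
pose g : {linear H -> H} := HB.pack f mx.
by exists (BOp (@bounded_linear_cont _ _ _ g M fM)).
Qed.
End MkBop.

Section Adjoint.
Context {R : realType} {H : hilbertType R}.
Implicit Types (x y z : H) (A B T : 'B(H)).

Lemma bop_bounded A : exists2 M : R, 0 <= M & forall x, rnorm (A x) <= M * rnorm x.
Proof. exact/linear_bounded_ex/bop_continuous. Qed.

(** Each [x |-> ip (T x) y] is bounded, so Riesz represents it by a vector that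
    depends linearly on [y]. *)
Lemma adj_exists T : exists A : 'B(H), forall x y, ip (T x) y = ip x (A y).
Proof.
have [M M0 hM] := bop_bounded T.
have /boolp.choice[g hg] y : exists z, forall x, ip (T x) y = ip x z.
  apply: (@Riesz _ _ _ (M * rnorm y)).
  - by move=> x x1; rewrite linearD ipDl.
  - by move=> a x; rewrite linearZ /= ipZl.
  - move=> x; apply: le_trans (ip_CS _ _) _.
    by rewrite mulrAC ler_wpM2r ?rnorm_ge0.
have gL : linear g.
  move=> a x y; apply: ip_inj => z.
  by rewrite -hg ipDr !ipZr !hg ipDr ipZr.
have gM y : rnorm (g y) <= M * rnorm y.
  have [->|gy0] := eqVneq (g y) 0; first by rewrite rnorm0 mulr_ge0 ?rnorm_ge0.
  have g0 : 0 < rnorm (g y).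
    by rewrite lt_def rnorm_ge0 andbT; apply: contra_neq gy0; apply: rnorm0_eq0.
  rewrite -(ler_pM2r g0).
  have -> : rnorm (g y) * rnorm (g y) = Rez (ip (T (g y)) y).
    by rewrite hg ip_sq.
  have := ip_CS (T (g y)) y; have := Re_le_rnorm (ip (T (g y)) y).
  have := ler_norm (Rez (ip (T (g y)) y)); have := hM (g y); have := rnorm_ge0 y.
  by nra.
by have [A hA] := mk_bop gL gM; exists A => x y; rewrite hA.
Qed.

Lemma adjP T x y : ip (T x) y = ip x (adj T y).
Proof.
rewrite /adj; case: xgetP => [A _ h|h]; first exact: h.
by have [A hA] := adj_exists T; case: (h A).
Qed.

Lemma adjPl T x y : ip (adj T x) y = ip x (T y).
Proof. by rewrite ipC -adjP -ipC. Qed.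

Lemma adj_unique T A : (forall x y, ip (T x) y = ip x (A y)) -> adj T = A.
Proof. by move=> h; apply: bopP => y; apply: ip_inj => x; rewrite -adjP h. Qed.

Lemma adjK T : adj (adj T) = T.
Proof. by apply: adj_unique => x y; rewrite adjPl. Qed.
Lemma adjM A B : adj (A * B) = adj B * adj A.
Proof. by apply: adj_unique => x y /=; rewrite !adjP. Qed.
Lemma adjD A B : adj (A + B) = adj A + adj B.
Proof. by apply: adj_unique => x y /=; rewrite ipDl ipDr !adjP. Qed.
Lemma adjN A : adj (- A) = - adj A.
Proof. by apply: adj_unique => x y /=; rewrite ipNl ipNr !adjP. Qed.
Lemma adjB A B : adj (A - B) = adj A - adj B.
Proof. by rewrite adjD adjN. Qed.
Lemma adj1 : adj 1 = 1 :> 'B(H).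
Proof. by apply: adj_unique. Qed.
Lemma adj0 : adj 0 = 0 :> 'B(H).
Proof. by apply: adj_unique => x y /=; rewrite ip0l ip0r. Qed.
Lemma adjMn A n : adj (A *+ n) = adj A *+ n.
Proof. by elim: n => [|n IH]; rewrite ?mulr0n ?adj0 // !mulrS adjD IH. Qed.
Lemma adjX A n : adj (A ^+ n) = adj A ^+ n.
Proof. by elim: n => [|n IH]; rewrite ?expr0 ?adj1 // exprS exprSr adjM IH. Qed.

Lemma bopME A B x : (A * B) x = A (B x). Proof. by []. Qed.
Lemma bopDE A B x : (A + B) x = A x + B x. Proof. by []. Qed.
Lemma bopNE A x : (- A) x = - A x. Proof. by []. Qed.
Lemma bop1E x : (1 : 'B(H)) x = x. Proof. by []. Qed.
Lemma bopMnE A n x : (A *+ n) x = A x *+ n.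
Proof. by elim: n => [|n IH]; rewrite ?mulr0n // !mulrS bopDE IH. Qed.

Lemma inv_opP T : invertible_op T -> inv_op T * T = 1 /\ T * inv_op T = 1.
Proof. by rewrite /inv_op => -[A hA]; case: xgetP => [B _ //|/(_ A)]. Qed.
End Adjoint.

Lemma commr_adj {R : realType} {H : hilbertType R} (A B : 'B(H)) :
  A * B = B * A -> adj A * adj B = adj B * adj A.
Proof. by move=> h; rewrite -!adjM h. Qed.

Lemma nat_mul_bounded {R : realType} (a b : R) :
  (forall n, n%:R * a <= b) -> a <= 0.
Proof.
move=> h; rewrite leNgt; apply/negP => a0.
have b0 : 0 <= b by have := h 0%N; rewrite mul0r.
have : b / a < (Num.bound (b / a))%:R by apply: archi_boundP; rewrite divr_ge0 // ltW.
by rewrite ltr_pdivrMr // ltNge h.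
Qed.

Lemma selfadjoint_real {R : realType} {H : hilbertType R} (A : 'B(H)) x :
  adj A = A -> ip (A x) x = toC (Rez (ip (A x) x)).
Proof.
move=> h; have := ipC (A x) x; rewrite -{1}h -adjP.
by case: (ip (A x) x) => a b [] /eqP; rewrite -addr_eq0 -mulr2n mulrn_eq0 => /eqP ->.
Qed.

Lemma rnorm_sq_adj {R : realType} {H : hilbertType R} (A : 'B(H)) x :
  rnorm (A x) ^+ 2 = Rez (ip ((adj A * A) x) x).
Proof. by rewrite ipC -adjP ip_sq ReJ. Qed.

Lemma ipMnl {R : realType} {H : hilbertType R} (x y : H) n :
  ip (x *+ n) y = ip x y *+ n.
Proof. by elim: n => [|n IH]; rewrite ?ip0l // !mulrS ipDl IH. Qed.

Lemma ReMn {R : realType} (z : R[i]) n : Rez (z *+ n) = n%:R * Rez z.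
Proof. by elim: n => [|n IH]; rewrite ?mul0r // mulrS ReD IH mulrSr; ring. Qed.

Lemma contractive_adj {R : realType} {H : hilbertType R} (A : 'B(H)) :
  (forall x, rnorm (A x) <= rnorm x) -> forall x, rnorm (adj A x) <= rnorm x.
Proof.
move=> hA x; have [->|n0] := eqVneq (adj A x) 0; first by rewrite rnorm0 rnorm_ge0.
have n1 : 0 < rnorm (adj A x).
  by rewrite lt_def rnorm_ge0 andbT; apply: contra_neq n0; apply: rnorm0_eq0.
rewrite -(ler_pM2r n1) -expr2 rnorm_sq_adj adjK bopME.
apply: le_trans (ler_norm _) _; apply: le_trans (Re_le_rnorm _) _.
apply: le_trans (ip_CS _ _) _; rewrite [leRHS]mulrC.
by rewrite ler_wpM2r ?rnorm_ge0.
Qed.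

Lemma contractiveX {R : realType} {H : hilbertType R} (A : 'B(H)) n :
  (forall x, rnorm (A x) <= rnorm x) -> forall x, rnorm ((A ^+ n) x) <= rnorm x.
Proof.
move=> hA; elim: n => [|n IH] x; first by rewrite expr0.
by rewrite exprSr bopME; apply: le_trans (IH _) (hA _).
Qed.

Lemma rnormMn {R : realType} {V : normedZmodType R[i]} (x : V) n :
  rnorm (x *+ n) = n%:R * rnorm x.
Proof. by rewrite /rnorm normrMn ReMn. Qed.

(** * The modulus of an expansive operator *)

Section Limits.
Context {R : realType} {V : normedModType R[i]}.
Implicit Types (u : nat -> V) (x : V).

Lemma tends_le u l (c : R) : tends u l -> (forall n, rnorm (u n) <= c) -> rnorm l <= c.
Proof.
move=> ul uc; apply/ler_addgt0Pr => e /ul[N /(_ N (leqnn N)) h].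
have := rnorm_tri (u N) l 0; rewrite !subr0 (rnormC l) => h'.
by have := uc N; lra.
Qed.

(** Summing the geometric series bounds [u (n + k) - u n] by
    [C q^n (1 - q^k) / (1 - q)]. *)
Lemma geometric_Cauchy u (C q : R) : 0 <= C -> 0 <= q < 1 ->
  (forall n, rnorm (u n.+1 - u n) <= C * q ^+ n) -> Cauchy u.
Proof.
move=> C0 /andP[q0 q1] h e e0.
have step n k : rnorm (u (n + k)%N - u n) <= C * q ^+ n / (1 - q) * (1 - q ^+ k).
  elim: k => [|k IH]; first by rewrite addn0 subrr rnorm0 expr0 subrr mulr0.
  apply: le_trans (rnorm_tri (u (n + k)%N) _ _) _.
  rewrite addnS; have := h (n + k)%N; rewrite exprD exprS.
  have -> : C * q ^+ n / (1 - q) * (1 - q * q ^+ k) =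
     C * q ^+ n / (1 - q) * (1 - q ^+ k) + C * (q ^+ n * q ^+ k) by field; lra.
  by lra.
have [N hN] : exists N, forall n, (N <= n)%N -> C * q ^+ n / (1 - q) < e.
  have k0 : 0 < e * (1 - q) / (C + 1) by rewrite divr_gt0 ?mulr_gt0 //; lra.
  have /cvgrPdist_lt/(_ _ k0)[N _ hN] : (fun n => q ^+ n) @ \oo --> (0 : R).
    by apply: cvg_expr; rewrite ger0_norm.
  exists N => n Nn; have := hN n Nn; rewrite /= sub0r normrN ger0_norm ?exprn_ge0 //.
  rewrite ltr_pdivlMr ?ltr_pdivrMr; [|lra..].
  by have := exprn_ge0 n q0; move: (q ^+ n) => t; nra.
have sym n k : (N <= n)%N -> rnorm (u (n + k)%N - u n) < e.
  move=> Nn; apply: le_lt_trans (step n k) _.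
  apply: le_lt_trans (hN n Nn); rewrite ler_piMr ?divr_ge0 ?mulr_ge0 ?exprn_ge0 //; first lra.
  by rewrite gerBl exprn_ge0.
exists N => m n Nm Nn; case/orP: (leq_total m n) => /subnKC <-.
  by rewrite rnormC sym.
exact: sym.
Qed.
End Limits.

Section Modulus.
Context {R : realType} {H : hilbertType R}.
Implicit Types (A B X Y C : 'B(H)).

Definition op_bound A (r : R) := forall x, rnorm (A x) <= r * rnorm x.

Lemma op_bound0 r : 0 <= r -> op_bound 0 r.
Proof. by move=> r0 x; rewrite rnorm0 mulr_ge0 ?rnorm_ge0. Qed.
Lemma op_boundD A B r s : op_bound A r -> op_bound B s -> op_bound (A + B) (r + s).
Proof. by move=> a b x; apply: le_trans (rnormD _ _) _; rewrite mulrDl lerD. Qed.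
Lemma op_boundM A B r s : 0 <= r -> op_bound A r -> op_bound B s -> op_bound (A * B) (r * s).
Proof.
by move=> r0 a b x; apply: le_trans (a _) _; rewrite -mulrA ler_wpM2l.
Qed.

Lemma scalar_op (c : R) : exists A : 'B(H), forall x, A x = toC c *: x.
Proof.
apply: (@mk_bop _ _ _ `|c|) => [a x y|x]; first by rewrite scalerDr !scalerA mulrC.
by rewrite rnormZ rnorm_real.
Qed.

Lemma tends_bop A u x : tends u x -> tends (fun n => A (u n)) (A x).
Proof.
move=> ux e e0; have [M M0 hM] := bop_bounded A.
have k0 : 0 < M + 1 by lra.
have [N h] := ux _ (divr_gt0 e0 k0); exists N => n /h; rewrite -linearB => h1.
apply: le_lt_trans (hM _) _; rewrite ltr_pdivlMr // in h1.
by have := rnorm_ge0 (u n - x); nra.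
Qed.

(** The uniform bound makes the pointwise limit a bounded operator. *)
Lemma pointwise_limit (Y_ : nat -> 'B(H)) r : (forall n, op_bound (Y_ n) r) ->
  (forall x, Cauchy (fun n => Y_ n x)) ->
  exists Y, op_bound Y r /\ forall x, tends (fun n => Y_ n x) (Y x).
Proof.
move=> Yr Yc.
have /boolp.choice[g hg] x : exists l, tends (fun n => Y_ n x) l.
  exact: Cauchy_complete.
have [] := @mk_bop _ _ g r.
- move=> a x y; apply: tends_uniq (hg _) _.
  have -> : (fun n => Y_ n (a *: x + y)) = (fun n => a *: Y_ n x + Y_ n y).
    by apply/funext => n; rewrite linearD linearZ.
  apply: tendsD (hg y).
  have [M hM] : exists M, forall z : H, rnorm (a *: z) <= M * rnorm z.
    by exists (rnorm a) => z; rewrite rnormZ.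
  move=> e e0; have k0 : 0 < rnorm a + 1 by have := rnorm_ge0 a; lra.
  have [N h] := hg x _ (divr_gt0 e0 k0); exists N => n /h; rewrite -scalerBr rnormZ.
  rewrite ltr_pdivlMr // => h1; apply: le_lt_trans h1; rewrite mulrC.
  by rewrite ler_wpM2l ?rnorm_ge0 // lerDl.
- by move=> x; apply: tends_le (hg x) _ => n; apply: Yr.
move=> Y hY; exists Y; split=> [x|x]; rewrite hY //.
by apply: tends_le (hg x) _ => n; apply: Yr.
Qed.

Lemma tends_op_uniq A B (Y_ : nat -> 'B(H)) :
  (forall x, tends (fun n => Y_ n x) (A x)) ->
  (forall x, tends (fun n => Y_ n x) (B x)) -> A = B.
Proof. by move=> hA hB; apply: bopP => x; apply: tends_uniq (hA x) (hB x). Qed.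

Section FixedPoint.
Variables (half X : 'B(H)) (r : R).
Hypothesis halfE : forall x, half x = toC 2^-1 *: x.
Hypothesis r01 : 0 <= r < 1.
Hypothesis Xr : op_bound X r.

(** Iterates of [Y |-> (X + Y^2) / 2].  A fixed point satisfies
    [(1 - Y)^2 = 1 - X], so that [1 - Y] is a square root of [1 - X]. *)
Fixpoint iter_sqrt n := if n is m.+1 then half * (X + iter_sqrt m * iter_sqrt m) else 0.

Lemma half_comm C : C * half = half * C.
Proof. by apply: bopP => x; rewrite !bopME !halfE linearZ. Qed.
Lemma half2 : half + half = 1.
Proof.
apply: bopP => x; rewrite bopDE !halfE -scalerDl -rmorphD /=.
have -> : 2^-1 + 2^-1 = 1 :> R by lra.
by rewrite scale1r.
Qed.
Lemma op_bound_half : op_bound half 2^-1.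
Proof. by move=> x; rewrite halfE rnormZ rnorm_real ger0_norm ?invr_ge0. Qed.

(** [(r + r^2) / 2 <= r] because [r <= 1]. *)
Lemma iter_sqrt_bound n : op_bound (iter_sqrt n) r.
Proof.
move: r01 => /andP[r0 r1].
elim: n => [|n IH]; first exact: op_bound0.
move=> x /=; have := op_boundM _ op_bound_half (op_boundD Xr (op_boundM r0 IH IH)).
move=> /(_ ltac:(lra) x) h; apply: le_trans h _.
by apply: ler_wpM2r; rewrite ?rnorm_ge0 //; nra.
Qed.

(** [A^2 - B^2 = A (A - B) + (A - B) B], so that each step shrinks the
    difference by the factor [r]. *)
Lemma iter_sqrt_step n : op_bound (iter_sqrt n.+1 - iter_sqrt n) (1 * r ^+ n).
Proof.
move: r01 => /andP[r0 r1]; elim: n => [|n IH].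
  move=> x; rewrite [iter_sqrt 0]/= subr0 expr0 mulr1.
  by apply: le_trans (iter_sqrt_bound _ _) _; rewrite ler_wpM2r ?rnorm_ge0 // ltW.
set A := iter_sqrt n.+1 in IH *; set B := iter_sqrt n in IH *.
have -> : iter_sqrt n.+2 - A = half * (A * (A - B) + (A - B) * B).
  rewrite {2}/A /= -/A -/B -mulrBr; congr (_ * _).
  by rewrite opprD addrACA subrr add0r mulrBr mulrBl subrKA.
have Ar := iter_sqrt_bound n.+1; have Br := iter_sqrt_bound n.
have rn : 0 <= 1 * r ^+ n by rewrite mul1r exprn_ge0.
have := op_boundM _ op_bound_half (op_boundD (op_boundM r0 Ar IH) (op_boundM rn IH Br)).
move=> /(_ ltac:(lra)) h x; apply: le_trans (h x) _.
apply: ler_wpM2r; rewrite ?rnorm_ge0 // exprS; lra.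
Qed.

Lemma half_fixpoint : exists Y, [/\ op_bound Y r, Y = half * (X + Y * Y)
  & forall x, tends (fun n => iter_sqrt n x) (Y x)].
Proof.
move: (r01) => /andP[r0 r1].
have [x|Y [Yr Ylim]] := pointwise_limit iter_sqrt_bound.
  apply: (@geometric_Cauchy _ _ _ (rnorm x) r) => // [|n]; first exact: rnorm_ge0.
  have := iter_sqrt_step n x; rewrite mul1r mulrC; exact: le_trans.
exists Y; split=> //.
apply: (@tends_op_uniq _ _ (fun n => iter_sqrt n.+1)) => x.
  move=> e e0; have [N h] := Ylim x e e0; exists N => n Nn; apply: h.
  exact: leqW.
apply: tends_bop; rewrite bopDE; apply: tendsD; first exact: tends_cst.
(* With [Y_n] for the iterates, [Y_n (Y_n x - Y x)] tends to [0] because the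
   [Y_n] are uniformly bounded. *)
have -> : (fun n => (iter_sqrt n * iter_sqrt n) x) =
  (fun n => iter_sqrt n (iter_sqrt n x - Y x) + iter_sqrt n (Y x)).
  by apply/funext => n; rewrite -linearD subrK.
rewrite -[(Y * Y) x]add0r; apply: tendsD; last exact: Ylim.
move=> e /(Ylim x)[N h]; exists N => n /h hn; rewrite subr0.
apply: le_lt_trans (iter_sqrt_bound _ _) _.
by have := rnorm_ge0 (iter_sqrt n x - Y x); nra.
Qed.

Lemma iter_sqrt_comm C n : C * X = X * C -> C * iter_sqrt n = iter_sqrt n * C.
Proof.
move=> CX; elim: n => [|n IH] /=; first by rewrite mulr0 mul0r.
rewrite mulrA half_comm -!mulrA; congr (_ * _).
by rewrite mulrDr mulrDl CX mulrA IH -!mulrA IH.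
Qed.

Lemma iter_sqrt_adj n : adj half = half -> adj X = X ->
  adj (iter_sqrt n) = iter_sqrt n.
Proof.
move=> ha Xa; elim: n => [|n IH] /=; first exact: adj0.
by rewrite adjM adjD Xa adjM IH ha half_comm.
Qed.
End FixedPoint.

Lemma scalar_op_comm (c : R) (s C : 'B(H)) :
  (forall x, s x = toC c *: x) -> C * s = s * C.
Proof. by move=> sE; apply: bopP => x; rewrite !bopME !sE linearZ. Qed.

Lemma scalar_op_adj (c : R) (s : 'B(H)) :
  (forall x, s x = toC c *: x) -> adj s = s.
Proof.
move=> sE; apply: adj_unique => x y; rewrite -!/(ip _ _) !sE ipZl ipZr.
by congr (_ * _); apply/esym/conj_Creal/complex_realP; exists c.
Qed.

Lemma tends_comm C Y (Y_ : nat -> 'B(H)) :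
  (forall x, tends (fun n => Y_ n x) (Y x)) ->
  (forall n, C * Y_ n = Y_ n * C) -> C * Y = Y * C.
Proof.
move=> hY hC; apply: (@tends_op_uniq _ _ (fun n => C * Y_ n)) => x.
  exact: tends_bop.
by under eq_fun do rewrite hC; apply: hY.
Qed.

Lemma tends_adj Y (Y_ : nat -> 'B(H)) :
  (forall x, tends (fun n => Y_ n x) (Y x)) ->
  (forall n, adj (Y_ n) = Y_ n) -> adj Y = Y.
Proof.
move=> hY ha; apply: adj_unique => x y; rewrite -!/(ip _ _).
apply: tends_uniq (tends_ip y (hY x)) _.
move=> e /(tends_ip x (hY y))[N h]; exists N => n /h.
have -> : ip (Y_ n x) y - ip x (Y y) = conjC (ip (Y_ n y) x - ip (Y y) x).
  by rewrite conjCB -!ipC adjP ha.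
by rewrite rnormJ.
Qed.

(** An expansive [T] has a Gram operator [Q >= 1].  With [c = M ^+ 2 + 1] for a
    bound [M] of [adj T], [1 - Q / c] has norm less than [1], the fixed point
    iteration gives a square root of [Q / c], and the square root commutes with
    whatever commutes with [Q] because the iterates do.  It is also bounded
    below, which makes it unique among the positive square roots. *)
Lemma sqrt_exists (T : 'B(H)) : (forall x : H, rnorm x <= rnorm (T x)) ->
  exists A : 'B(H), [/\ A * A = adj T * T, adj A = A,
    exists2 d : R, 0 < d & forall x : H, d * rnorm x ^+ 2 <= Rez (ip (A x) x)
  & forall C, C * (adj T * T) = (adj T * T) * C -> C * A = A * C].
Proof.
move=> hT; have [M M0 hM] := bop_bounded (adj T).
set c := M ^+ 2 + 1; have c1 : 1 <= c by rewrite /c lerDr sqr_ge0.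
have c0 : 0 < c by lra.
have [k kE] := scalar_op c^-1; have [s sE] := scalar_op (Num.sqrt c).
have [h hE] := scalar_op 2^-1.
set Q := adj T * T; pose X := 1 - k * Q.
have ci0 : 0 < c^-1 by rewrite invr_gt0.
have ci1 : c^-1 <= 1 by rewrite invf_le1.
have r01 : 0 <= Num.sqrt (1 - c^-1) < 1.
  rewrite sqrtr_ge0 -[X in _ < X]sqrtr1 ltr_sqrt //; lra.
(* [|X x|^2 <= |x|^2 - |T x|^2 / c <= (1 - 1 / c) |x|^2] *)
have Xr : op_bound X (Num.sqrt (1 - c^-1)).
  move=> x; rewrite -(@ler_pXn2r _ 2) ?nnegrE ?mulr_ge0 ?rnorm_ge0 ?sqrtr_ge0 //.
  rewrite exprMn sqr_sqrtr; last lra.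
  rewrite /X bopDE bopNE bopME bop1E kE rnormB2 rnormZ rnorm_real ger0_norm ?(ltW ci0) //.
  rewrite [ip x _]ipC ipZl ReJ ReM -rnorm_sq_adj exprMn.
  have := hM (T x); have := hT x; have := rnorm_ge0 x; have := rnorm_ge0 (Q x).
  rewrite -[adj T (T x)]/(Q x); move: (rnorm (Q x)) (rnorm (T x)) (rnorm x) => q t u.
  move=> q0 u0 ut qMt.
  have q2 : q ^+ 2 <= c * t ^+ 2.
    have : q ^+ 2 <= (M * t) ^+ 2 by rewrite ler_pXn2r ?nnegrE // (le_trans q0).
    by rewrite exprMn /c; have := sqr_ge0 t; lra.
  have : c^-1 ^+ 2 * q ^+ 2 <= c^-1 * t ^+ 2.
    apply: le_trans (_ : c^-1 ^+ 2 * (c * t ^+ 2) <= _).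
      by rewrite ler_wpM2l // sqr_ge0.
    have -> // : c^-1 ^+ 2 * (c * t ^+ 2) = c^-1 * t ^+ 2 by field; lra.
  have : u ^+ 2 <= t ^+ 2 by rewrite ler_pXn2r ?nnegrE // (le_trans u0).
  by nra.
have [Y [Yr Yfix Ylim]] := half_fixpoint hE r01 Xr.
have kQ : adj k = k := scalar_op_adj kE.
have Qa : adj Q = Q by rewrite /Q adjM adjK.
have Xa : adj X = X by rewrite /X adjB adj1 adjM kQ Qa (scalar_op_comm _ kE).
have Ya : adj Y = Y.
  apply: tends_adj Ylim _ => n; apply: (iter_sqrt_adj hE) => //.
  exact: scalar_op_adj hE.
have YY : Y * Y = Y + Y - X.
  have -> : Y + Y = X + Y * Y.
    by rewrite -[RHS]mul1r -(half2 hE) mulrDl -Yfix.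
  by rewrite addrAC subrr add0r.
exists (s * (1 - Y)); split.
- rewrite mulrA -(mulrA s) (scalar_op_comm _ sE) mulrA -mulrA.
  have -> : (1 - Y) * (1 - Y) = k * Q.
    rewrite mulrBl mul1r mulrBr mulr1 YY.
    have -> : Y - (Y + Y - X) = X - Y.
      by rewrite opprB addrCA opprD (addrA Y) subrr add0r.
    by rewrite opprB subrKA subKr.
  apply: bopP => x; rewrite !bopME !sE kE !scalerA -!rmorphM /=.
  have -> : Num.sqrt c * Num.sqrt c / c = 1.
    by rewrite -expr2 sqr_sqrtr ?(ltW c0) // divff // lt0r_neq0.
  by rewrite scale1r.
- by rewrite adjM (scalar_op_adj sE) adjB adj1 Ya (scalar_op_comm _ sE).
- exists (Num.sqrt c * (1 - Num.sqrt (1 - c^-1))).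
    by rewrite mulr_gt0 ?sqrtr_gt0 //; lra.
  move=> x; rewrite bopME sE ipZl ReM -mulrA ler_wpM2l ?sqrtr_ge0 //.
  rewrite bopDE bopNE bop1E ipBl ReB ip_sq /= mulrBl mul1r lerB //.
  have := Re_le_rnorm (ip (Y x) x); have := ler_norm (Rez (ip (Y x) x)).
  have := ip_CS (Y x) x; have := Yr x; have := rnorm_ge0 x; nra.
- move=> C CQ; rewrite mulrA (scalar_op_comm _ sE) -!mulrA; congr (_ * _).
  rewrite mulrBr mulrBl mulr1 mul1r; congr (_ - _).
  apply: tends_comm Ylim _ => n; apply: (iter_sqrt_comm hE).
  rewrite /X mulrBr mulrBl mulr1 mul1r; congr (_ - _).
  by rewrite mulrA (scalar_op_comm C kE) -(mulrA k C) CQ mulrA.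
Qed.

(** Uniqueness of the square root: a positive square root [A'] commutes with the
    one constructed above, [A], so that [(A + A') (A' - A) = 0]; as [A] is bounded
    below, [A' - A = 0]. *)
Lemma modulus_sqr_comm (T : 'B(H)) : (forall x : H, rnorm x <= rnorm (T x)) ->
  modulus T * modulus T = adj T * T /\
  forall C, C * (adj T * T) = (adj T * T) * C -> C * modulus T = modulus T * C.
Proof.
move=> /sqrt_exists[A [AA Aa [d d0 Ad] AC]].
suff uniq A' : positive_op A' -> A' * A' = adj T * T -> A' = A.
  have -> : modulus T = A; last by [].
  rewrite /modulus /sqrt_op; case: xgetP => [A' _ [pA' AA']|/(_ A)]; first exact: uniq.
  case; split=> // x; rewrite -/(ip _ _) selfadjoint_real // lecR.
  by apply: le_trans (Ad x); rewrite mulr_ge0 ?sqr_ge0 // ltW.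
move=> pA' AA'.
have comA : A' * A = A * A' by apply: AC; rewrite -AA' mulrA.
have Z0 : (A + A') * (A' - A) = 0.
  by rewrite mulrDl !mulrBr AA AA' comA subrKA subrr.
apply/eqP; rewrite -subr_eq0; apply/eqP/bopP => x; set z := (A' - A) x.
have : ip ((A + A') z) z = 0 by rewrite -bopME Z0 ip0l.
rewrite bopDE ipDl => /(congr1 (@complex.Re R)); rewrite ReD /= => e.
have := Ad z; have : 0 <= Rez (ip (A' z) z).
  by have := pA' z; rewrite -/(ip _ _) lecE => /andP[].
have := sqr_ge0 (rnorm z) => a b c.
have : rnorm z ^+ 2 <= 0 by nra.
by move=> h; apply: rnorm0_eq0; apply/eqP; rewrite -sqrf_eq0 eq_le sqr_ge0 h.
Qed.

End Modulus.

(** * Cauchy kernels of commuting operators *)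

Section Sums.
Context {R : realType} {H : hilbertType R}.
Implicit Types (I : Type).

Lemma ip_suml I (r : seq I) (F : I -> H) y :
  ip (\sum_(i <- r) F i) y = \sum_(i <- r) ip (F i) y.
Proof. by elim/big_rec2: _ => [|i a b _ <-]; rewrite ?ip0l ?ipDl. Qed.
Lemma ip_sumr I (r : seq I) (F : I -> H) y :
  ip y (\sum_(i <- r) F i) = \sum_(i <- r) ip y (F i).
Proof. by elim/big_rec2: _ => [|i a b _ <-]; rewrite ?ip0r ?ipDr. Qed.

Lemma ip_sum2 I (r : seq I) (A : 'B(H)) (F G : I -> H) :
  ip (A (\sum_(q <- r) F q)) (\sum_(p <- r) G p) =
  \sum_(p <- r) \sum_(q <- r) ip (A (F q)) (G p).
Proof.
by rewrite linear_sum ip_sumr; apply: eq_bigr => p _; rewrite ip_suml.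
Qed.
End Sums.

Section CauchyKernel.
Context {R : realType} {H : hilbertType R} {I : Type}.
Variables (C Y : I -> I -> 'B(H)).
Hypothesis CC : forall p q p' q', C p q * C p' q' = C p' q' * C p q.
Hypothesis C2 : forall p q, C p q *+ 2 = C p p + C q q.
Hypothesis Ca : forall p q, adj (C p q) = C p q.
Hypothesis C_ge0 : forall p x, 0 <= ip (C p p x) x.
Hypothesis YC : forall p q, Y p q * C p q = 1.
Hypothesis CY : forall p q, C p q * Y p q = 1.

Lemma inverse_comm p q A : C p q * A = A * C p q -> Y p q * A = A * Y p q.
Proof.
by move=> h; rewrite -[LHS]mulr1 -(CY p q) mulrA -(mulrA _ A) -h mulrA YC mul1r.
Qed.

Lemma adj_inverse p q : adj (Y p q) = Y p q.
Proof.
have := congr1 adj (YC p q); rewrite adjM adj1 Ca => h.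
by rewrite -[LHS]mul1r -(YC p q) -mulrA h mulr1.
Qed.

(** One step of Gaussian elimination for the Cauchy kernel.  With [x_p = C p p / 2]
    and [y_pq = 1 / (x_p + x_q)], it is the rational identity
    [y_pq = 2 x_o y_po y_qo + (x_p - x_o) y_po y_pq (x_q - x_o) y_qo],
    multiplied by [4] to avoid halves. *)
Lemma cauchy_identity o p q : Y p q *+ 4 =
  (Y p o * C o o * Y q o) *+ 4 +
  (Y p o * (C p p - C o o)) * (Y p q * ((C q q - C o o) * Y q o)).
Proof.
have prod : (C p o * C q o) *+ 4 =
    (C o o * C p q) *+ 4 + (C p p - C o o) * (C q q - C o o).
  have -> : (C p o * C q o) *+ 4 = (C p o *+ 2) * (C q o *+ 2).
    by rewrite mulrnAl mulrnAr -mulrnA.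
  have -> : (C o o * C p q) *+ 4 = (C o o * (C p q *+ 2)) *+ 2.
    by rewrite mulrnAr -mulrnA.
  rewrite !C2; have := CC p p o o.
  move: (C p p) (C q q) (C o o) => a b c ac.
  have -> : (a + c) * (b + c) = (a * b + c * c) + (c * a + c * b).
    by rewrite mulrDl !mulrDr ac [c * b + _]addrC addrACA.
  have -> : (a - c) * (b - c) = (a * b + c * c) - (c * a + c * b).
    by rewrite mulrBl !mulrBr ac opprB addrACA -opprD.
  by rewrite mulrDr mulr2n [RHS]addrCA addrK.
have uC r s : Y p q * C r s = C r s * Y p q by apply: inverse_comm; apply: CC.
have -> : Y p q *+ 4 = Y p o * (Y p q * ((C p o * C q o) *+ 4)) * Y q o.
  rewrite mulrnAr mulrnAr mulrnAl; congr (_ *+ _).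
  by rewrite (mulrA (Y p q)) uC -!mulrA CY mulr1 mulrA YC mul1r.
have uE : Y p q * (C p p - C o o) = (C p p - C o o) * Y p q.
  by rewrite mulrBr mulrBl !uC.
rewrite prod; move: (C p p - C o o) (C q q - C o o) uE => E E' uE.
have -> : Y p q * (C o o * C p q *+ 4 + E * E') = C o o *+ 4 + Y p q * (E * E').
  by rewrite mulrDr mulrnAr CC mulrA YC mul1r.
rewrite mulrDr mulrDl mulrnAr mulrnAl; congr (_ + _).
by rewrite (mulrA (Y p q)) uE !mulrA.
Qed.

(** Induction on the list of points: eliminating the first point [o] leaves a
    nonnegative square and the same kernel on vectors [g] that vanish at [o]. *)
Lemma cauchy_psd (r : seq I) (v : I -> H) :
  0 <= \sum_(p <- r) \sum_(q <- r) ip (Y p q (v q)) (v p).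
Proof.
elim: r v => [|o l IH] v; first by rewrite big_nil.
set r := o :: l.
pose w q := Y q o (v q); pose g q := (C q q - C o o) (w q).
rewrite -(@pmulrn_lge0 _ _ 4) //.
have -> : (\sum_(p <- r) \sum_(q <- r) ip (Y p q (v q)) (v p)) *+ 4 =
  ip (C o o (\sum_(q <- r) w q)) (\sum_(q <- r) w q) *+ 4 +
  \sum_(p <- r) \sum_(q <- r) ip (Y p q (g q)) (g p).
  rewrite ip_sum2 -!sumrMnl -big_split /=; apply: eq_bigr => p _.
  rewrite -!sumrMnl -big_split /=; apply: eq_bigr => q _.
  rewrite -ipMnl -bopMnE (cauchy_identity o p q) bopDE bopMnE ipDl ipMnl.
  congr (_ *+ _ + _).
    by rewrite -[LHS]/(ip (Y p o (C o o (w q))) (v p)) adjP adj_inverse.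
  rewrite -[LHS]/(ip ((Y p o * (C p p - C o o)) (Y p q (g q))) (v p)) adjP.
  by rewrite adjM adjB !Ca adj_inverse.
have g0 : g o = 0 by rewrite /g subrr.
apply: addr_ge0; first by rewrite mulrn_wge0 ?C_ge0.
have -> : \sum_(p <- r) \sum_(q <- r) ip (Y p q (g q)) (g p) =
  \sum_(p <- l) \sum_(q <- l) ip (Y p q (g q)) (g p); last exact: IH.
rewrite big_cons big1 ?add0r => [|q _]; last by rewrite g0 ip0r.
by apply: eq_bigr => p _; rewrite big_cons g0 linear0 ip0l add0r.
Qed.
End CauchyKernel.

(** * Reduction to a Hankel-type kernel in one variable *)

Section OneVariable.
Context {R : realType} {H : hilbertType R} {I : eqType}.
Variables (S L : 'B(H)) (Z W : I -> I -> 'B(H)) (r : seq I).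
Hypothesis LS : L * S = 1.
Hypothesis proj_adj : forall k, adj (S ^+ k * L ^+ k) = S ^+ k * L ^+ k.
Hypothesis ZS : forall p q, Z p q * S = S * Z p q.
Hypothesis ZL : forall p q, Z p q * L = L * Z p q.
Hypothesis WS : forall p q, W p q * S = S * W p q.
Hypothesis WL : forall p q, W p q * L = L * W p q.

(** The part of the Bram-Halmos form that concerns one variable: the point [p] has
    degree [n p] in this variable, the factors [Z p q] and [W p q] collect the
    other variables, and [m] counts the degrees that earlier reductions have
    stripped off. *)
Definition split_form (n : I -> nat) m (h : I -> H) (g : I -> H) : R[i] :=
  \sum_(p <- r) \sum_(q <- r)
    ip ((S ^+ (n p + m) * Z p q) (h q)) ((S ^+ (n q + m) * W p q) (g p)).

(** What [split_form] becomes on families of the form [S ^+ n q (v q)]: the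
    exponents only enter through the sum [n p + n q]. *)
Definition joint_form (n : I -> nat) m (v : I -> H) : R[i] :=
  \sum_(p <- r) \sum_(q <- r)
    ip ((S ^+ (n p + n q + m) * Z p q) (v q))
       ((S ^+ (n p + n q + m) * W p q) (v p)).

Hypothesis joint_ge0 : forall n m v, 0 <= joint_form n m v.

Let LSX k : L ^+ k * S ^+ k = 1.
Proof.
elim: k => [|k IH]; first by rewrite !expr0 mulr1.
by rewrite exprSr exprS mulrA -(mulrA _ L) LS mulr1.
Qed.

Let LSXE k x : (L ^+ k) ((S ^+ k) x) = x.
Proof. by rewrite -bopME LSX. Qed.

(** [S ^+ k * L ^+ k] is an orthogonal projection, so its range is orthogonal to
    its kernel. *)
Lemma range_kernel_orth k x y : (L ^+ k) y = 0 -> ip ((S ^+ k) x) y = 0.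
Proof.
move=> Ly; have -> : S ^+ k = S ^+ k * L ^+ k * S ^+ k.
  by rewrite -mulrA LSX mulr1.
by rewrite bopME adjP proj_adj bopME Ly linear0 ip0r.
Qed.

Lemma dual_pow_comm (A : 'B(H)) a b m x : A * S = S * A ->
  (S ^+ (a + m) * A) ((S ^+ b) x) = (S ^+ (a + b + m) * A) x.
Proof.
move=> AS; have ASX : A * S ^+ b = S ^+ b * A by apply: commrX.
rewrite -[LHS]/((S ^+ (a + m) * A * S ^+ b) x); congr (bop_fun _ x).
by rewrite -mulrA ASX mulrA -exprD addnAC.
Qed.

Lemma split_cross (A B : 'B(H)) a b m x y :
  A * S = S * A -> B * L = L * B -> (L ^+ a) y = 0 ->
  ip ((S ^+ (a + m) * A) ((S ^+ b) x)) ((S ^+ (b + m) * B) y) = 0.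
Proof.
move=> AS BL Ly.
have BLX : B * L ^+ a = L ^+ a * B by apply: commrX.
rewrite dual_pow_comm // -addnA.
apply: range_kernel_orth; rewrite -bopME.
rewrite exprD -!mulrA (mulrA (L ^+ (b + m))) LSX mul1r -BLX bopME Ly.
by rewrite linear0.
Qed.

Lemma split_formD n m (h h' g : I -> H) :
  split_form n m (fun p => h p + h' p) g = split_form n m h g + split_form n m h' g.
Proof.
rewrite /split_form -big_split; apply: eq_bigr => p _ /=.
by rewrite -big_split; apply: eq_bigr => q _ /=; rewrite !linearD ipDl.
Qed.

Lemma split_formDr n m (h h' g : I -> H) :
  split_form n m g (fun p => h p + h' p) = split_form n m g h + split_form n m g h'.
Proof.
rewrite /split_form -big_split; apply: eq_bigr => p _ /=.
by rewrite -big_split; apply: eq_bigr => q _ /=; rewrite !linearD ipDr.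
Qed.

(** The cross terms pair the range of a power of [S] with the kernel of the same
    power of [L]. *)
Lemma split_form_range n m h :
  let g p := h p - (S ^+ n p) ((L ^+ n p) (h p)) in
  split_form n m h h =
  joint_form n m (fun p => (L ^+ n p) (h p)) + split_form n m g g.
Proof.
move=> g; pose v p := (L ^+ n p) (h p); pose v' p := (S ^+ n p) (v p).
have Lg p : (L ^+ n p) (g p) = 0 by rewrite /g linearB LSXE subrr.
have hE : h = fun p => v' p + g p by apply/funext => p; rewrite addrC subrK.
have -> : split_form n m h h =
    split_form n m (fun p => v' p + g p) (fun p => v' p + g p) by rewrite -hE.
rewrite split_formD !(split_formDr n m v' g) -/v.
have -> : split_form n m v' g = 0.
  rewrite /split_form big1 // => p _; rewrite big1 // => q _.
  exact: split_cross.
have -> : split_form n m g v' = 0.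
  rewrite /split_form big1 // => p _; rewrite big1 // => q _.
  by rewrite ipC split_cross ?conjC0.
rewrite addr0 add0r; congr (_ + _); apply: eq_bigr => p _.
by apply: eq_bigr => q _; rewrite !dual_pow_comm // [(n q + n p)%N]addnC.
Qed.

(** Induction on the largest degree.  The component of [h p] off the range of
    [S ^+ n p] vanishes when [n p = 0], so that all the degrees that occur in its
    form can be lowered by one while [m] is raised by one. *)
Lemma split_form_ge0 N n m h : (forall p, p \in r -> (n p <= N)%N) ->
  0 <= split_form n m h h.
Proof.
elim: N n m h => [|N IH] n m h nN; rewrite split_form_range;
  set g := fun p => h p - _;
  (have g0 p : n p = 0%N -> g p = 0
     by move=> np; rewrite /g np !expr0 subrr).
  rewrite [split_form _ _ _ _]big1_seq ?addr0 // => p /nN.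
  rewrite leqn0 => /eqP/g0 gp.
  by rewrite big1 // => q _; rewrite gp !linear0 ip0r.
have -> : split_form n m g g = split_form (fun p => (n p).-1) m.+1 g g.
  apply: eq_bigr => p _; apply: eq_bigr => q _.
  have [/g0 ->|np] := posnP (n p); first by rewrite !linear0 !ip0r.
  have [/g0 ->|nq] := posnP (n q); first by rewrite !linear0 !ip0l.
  by rewrite !addnS -!addSn !prednK.
apply: addr_ge0; first exact: joint_ge0.
apply: IH => p /nN; by case: (n p).
Qed.
End OneVariable.

(** * Completion of a positive semidefinite form *)

(** In a normed module, completeness for sequences gives completeness for
    filters: pick centers of balls of radius [1 / (n + 1)] that belong to the
    filter. *)
Lemma Cauchy_cvg {R : realType} {V : normedModType R[i]} :
  (forall u : nat -> V, Cauchy u -> exists l, tends u l) ->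
  forall F : set_system V, ProperFilter F -> cauchy F -> cvg F.
Proof.
move=> VC F FF /cauchyP Fc.
have pos n : 0 < toC (n.+1%:R^-1 : R) by rewrite ltcR invr_gt0 ltr0Sn.
have /boolp.choice[u hu] n : exists x : V, F (ball x (toC (n.+1%:R^-1 : R))).
  exact: Fc.
have [e e0|l ul] := VC u.
  have e2 : 0 < e / 2 by lra.
  have [N hN] := inv_nat_small e2; exists N => m n Nm Nn.
  have [y [ym yn]] := filter_ex (filterI (hu m) (hu n)).
  rewrite -ball_normE /= rnormE ltcR in ym; rewrite -ball_normE /= rnormE ltcR in yn.
  have := rnorm_tri y (u m) (u n); rewrite (rnormC y).
  move: ym yn (hN _ Nm) (hN _ Nn); move: (m.+1%:R^-1) (n.+1%:R^-1) => a b.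
  by lra.
apply/cvg_ex; exists l; apply/cvgrPdist_lt => e e0.
have e0' : 0 < Rez e by rewrite -ltcR -(ge0_toC (ltW e0)).
have e2 : 0 < Rez e / 2 by lra.
have [N1 h1] := inv_nat_small e2; have [N2 h2] := ul _ e2.
set n := maxn N1 N2; have {}h1 := h1 n (leq_maxl _ _); have {}h2 := h2 n (leq_maxr _ _).
apply: filterS (hu n) => y; rewrite -ball_normE /= rnormE ltcR => yn.
rewrite rnormE (ge0_toC (ltW e0)) ltcR; have := rnorm_tri (u n) l y; rewrite (rnormC l (u n)).
move: yn h1 h2; move: (n.+1%:R^-1) => a.
by lra.
Qed.

Section SemiNormSequences.
Context {R : realType} {D : lmodType R[i]}.
Variable (f : {hermitian D for false & conjC}).
Hypothesis f_ge0 : forall x, 0 <= f x x.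

Definition semi_Cauchy (u : nat -> D) := forall e : R, 0 < e ->
  exists N, forall m n, (N <= m)%N -> (N <= n)%N -> seminorm f (u m - u n) < e.

Lemma semi_Cauchy_bounded u : semi_Cauchy u ->
  exists2 M, 0 < M & exists N, forall n, (N <= n)%N -> seminorm f (u n) <= M.
Proof.
move=> cu; have [N h] := cu 1 ltr01.
exists (seminorm f (u N) + 1); first by have := seminorm_ge0 f (u N); lra.
exists N => n Nn; have := h n N Nn (leqnn N).
by have := seminormD f_ge0 (u n - u N) (u N); rewrite subrK; lra.
Qed.

Lemma form_tends_0l u v (M : R) : 0 < M ->
  (exists N, forall n, (N <= n)%N -> seminorm f (u n) <= M) ->
  (forall e : R, 0 < e -> exists N, forall n, (N <= n)%N -> seminorm f (v n) < e) ->
  tends (fun n => f (u n) (v n)) 0.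
Proof.
move=> M0 [N uM] v0 e e0; have [N' h] := v0 _ (divr_gt0 e0 M0).
exists (maxn N N') => n; rewrite geq_max subr0 => /andP[/uM a /h].
rewrite ltr_pdivlMr // => b; apply: le_lt_trans (form_CS f_ge0 _ _) _.
apply: le_lt_trans b; rewrite mulrC ler_wpM2l ?seminorm_ge0 //.
Qed.

Lemma form_Cauchy u v : semi_Cauchy u -> semi_Cauchy v ->
  Cauchy (fun n => f (u n) (v n)).
Proof.
move=> cu cv; have [Mu Mu0 [Nu hu]] := semi_Cauchy_bounded cu.
have [Mv Mv0 [Nv hv]] := semi_Cauchy_bounded cv.
move=> e e0; have e2 : 0 < e / 2 by lra.
have [N1 h1] := cu _ (divr_gt0 e2 Mv0); have [N2 h2] := cv _ (divr_gt0 e2 Mu0).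
exists (maxn (maxn Nu Nv) (maxn N1 N2)) => m n.
rewrite !geq_max => /andP[/andP[um vm] /andP[m1 m2]] /andP[/andP[un vn] /andP[n1 n2]].
have -> : f (u m) (v m) - f (u n) (v n) =
    f (u m - u n) (v m) + f (u n) (v m - v n).
  by rewrite linearBl linearBr /= addrA subrK.
apply: le_lt_trans (rnormD _ _) _.
have := form_CS f_ge0 (u m - u n) (v m); have := form_CS f_ge0 (u n) (v m - v n).
have := hu n un; have := hv m vm; have := h1 m n m1 n1; have := h2 m n m2 n2.
rewrite !ltr_pdivlMr //.
have := seminorm_ge0 f (u n); have := seminorm_ge0 f (v m).
have := seminorm_ge0 f (u m - u n); have := seminorm_ge0 f (v m - v n).
by nra.
Qed.

(** This is why a point of the completion is determined by its products with the
    elements of [D]. *)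
Lemma weak_null u : semi_Cauchy u -> (forall y, tends (fun n => f (u n) y) 0) ->
  forall e : R, 0 < e -> exists N, forall n, (N <= n)%N -> seminorm f (u n) < e.
Proof.
move=> cu w e e0; have [M M0 [N hM]] := semi_Cauchy_bounded cu.
have e2 : 0 < e ^+ 2 / 2 by rewrite divr_gt0 ?exprn_gt0.
have [N1 h1] := cu _ (divr_gt0 e2 M0).
(* [f (u n) (u n)] is the sum of [f (u n) (u n - u N1)], small because [u] is
   Cauchy, and of [f (u n) (u N1)], small by weak convergence. *)
have [N2 h2] := w (u N1) _ e2.
exists (maxn N (maxn N1 N2)) => n; rewrite !geq_max => /and3P[/hM nM n1 n2].
rewrite -(@ltr_pXn2r _ 2) ?nnegrE ?seminorm_ge0 ?(ltW e0) // seminorm_sqr //.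
have -> : sqnorm f (u n) = Rez (f (u n) (u n - u N1) + f (u n) (u N1)).
  by rewrite linearBr /= subrK.
rewrite ReD; have := h2 n n2; rewrite subr0.
have := h1 n N1 n1 (leqnn _); rewrite ltr_pdivlMr //.
have := form_CS f_ge0 (u n) (u n - u N1).
have := ler_norm (Rez (f (u n) (u N1))); have := Re_le_rnorm (f (u n) (u N1)).
have := ler_norm (Rez (f (u n) (u n - u N1))); have := Re_le_rnorm (f (u n) (u n - u N1)).
have := seminorm_ge0 f (u n); have := seminorm_ge0 f (u n - u N1).
by nra.
Qed.

Lemma semi_Cauchy_lin a u v : semi_Cauchy u -> semi_Cauchy v ->
  semi_Cauchy (fun n => a *: u n + v n).
Proof.
move=> cu cv e e0; have k0 : 0 < rnorm a + 1 by have := rnorm_ge0 a; lra.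
have e2 : 0 < e / 2 by lra.
have [N1 h1] := cu _ (divr_gt0 e2 k0); have [N2 h2] := cv _ e2.
exists (maxn N1 N2) => m n; rewrite !geq_max => /andP[m1 m2] /andP[n1 n2].
rewrite opprD addrACA -scalerBr; apply: le_lt_trans (seminormD f_ge0 _ _) _.
rewrite seminormZ //; have := h1 m n m1 n1; have := h2 m n m2 n2.
rewrite (ltr_pdivlMr _ _ k0); have := seminorm_ge0 f (u m - u n); have := rnorm_ge0 a.
by nra.
Qed.

Lemma semi_Cauchy_cst x : semi_Cauchy (fun=> x).
Proof.
by move=> e e0; exists 0%N => m n _ _; rewrite subrr /seminorm /sqnorm linear0l sqrtr0.
Qed.

(** A Cauchy sequence [u] of [D] stands for the antilinear functional
    [y |-> lim f (u n) y].  By [weak_null], equivalent sequences are those with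
    the same functional, so that functionals can serve as points of the
    completion and no quotient is needed. *)
Definition represents (u : nat -> D) (phi : D -> R[i]) :=
  semi_Cauchy u /\ forall y, tends (fun n => f (u n) y) (phi y).

Definition completion_pred : {pred (D -> R[i])} :=
  fun phi => `[< exists u, represents u phi >].

Lemma represents_lin a u v phi psi : represents u phi -> represents v psi ->
  represents (fun n => a *: u n + v n) (fun y => a * phi y + psi y).
Proof.
move=> [cu hu] [cv hv]; split=> [|y]; first exact: semi_Cauchy_lin.
under eq_fun do rewrite linearPl.
apply: tendsD (hv y) => e e0; have k0 : 0 < rnorm a + 1 by have := rnorm_ge0 a; lra.
have [N h] := hu y _ (divr_gt0 e0 k0); exists N => n /h.
rewrite -mulrBr rnormM ltr_pdivlMr //.
by have := rnorm_ge0 a; have := rnorm_ge0 (f (u n) y - phi y); nra.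
Qed.

Lemma completion_closed : submod_closed completion_pred.
Proof.
split=> [|a phi psi /asboolP[u hu] /asboolP[v hv]]; apply/asboolP.
  exists (fun=> 0); split=> [|y]; first exact: semi_Cauchy_cst.
  by under eq_fun do rewrite linear0l; apply: tends_cst.
by exists (fun n => a *: u n + v n); apply: represents_lin.
Qed.

HB.instance Definition _ := GRing.isSubmodClosed.Build _ _ completion_pred
  completion_closed.

(** The completion as a set of functionals.  The variant [completion] remembers
    the positivity of [f], on which the norm depends. *)
Record completion_of := Completion
  { cfun :> D -> R[i]; cfunP : cfun \in completion_pred }.
Definition completion of (forall x, 0 <= f x x) := completion_of.
Local Notation K := (completion f_ge0).

HB.instance Definition _ := [isSub of completion_of for cfun].
HB.instance Definition _ := [Choice of completion_of by <:].
HB.instance Definition _ := [SubChoice_isSubLmodule of completion_of by <:].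
HB.instance Definition _ := GRing.Lmodule.on K.

Lemma completionP (phi : K) : exists u, represents u phi.
Proof. by have /asboolP := cfunP phi. Qed.

Lemma completion_ext (phi psi : K) : (forall y, phi y = psi y) -> phi = psi.
Proof. by move=> h; apply: val_inj; apply/funext. Qed.

Definition repr_seq (phi : K) : nat -> D := projT1 (cid (completionP phi)).
Lemma repr_seq_represents phi : represents (repr_seq phi) phi.
Proof. by rewrite /repr_seq; case: cid. Qed.

Definition cdot (phi psi : K) : R[i] :=
  xget 0 [set l | tends (fun n => f (repr_seq phi n) (repr_seq psi n)) l].

Lemma represents_diff u v phi : represents u phi -> represents v phi ->
  forall e : R, 0 < e -> exists N, forall n, (N <= n)%N -> seminorm f (u n - v n) < e.
Proof.
move=> [cu hu] [cv hv]; apply: weak_null.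
  have := semi_Cauchy_lin (-1) cv cu; congr semi_Cauchy.
  by apply/funext => n; rewrite scaleN1r addrC.
move=> y; have := tendsB (hu y) (hv y); rewrite subrr.
by congr tends; apply/funext => n; rewrite linearBl.
Qed.

Lemma cdot_tends u v (phi psi : K) : represents u phi -> represents v psi ->
  tends (fun n => f (u n) (v n)) (cdot phi psi).
Proof.
move=> ru rv; have rp := repr_seq_represents phi; have rq := repr_seq_represents psi.
have h0 : tends (fun n => f (repr_seq phi n) (repr_seq psi n)) (cdot phi psi).
  rewrite /cdot; case: xgetP => [l -> //|/(_ _) no].
  have [l hl] := Cauchy_complex (form_Cauchy rp.1 rq.1).
  by case: (no l).
have [Mu Mu0 hu] := semi_Cauchy_bounded ru.1.
have [Mq Mq0 hq] := semi_Cauchy_bounded rq.1.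
have a : tends (fun n => f (u n) (v n - repr_seq psi n)) 0.
  by apply: form_tends_0l Mu0 hu (represents_diff rv rq).
have b : tends (fun n => f (u n - repr_seq phi n) (repr_seq psi n)) 0.
  have := form_tends_0l Mq0 hq (represents_diff ru rp).
  move=> h e /h[N hN]; exists N => n /hN; rewrite !subr0.
  by rewrite [f (repr_seq _ _) _]formC rnormJ.
have := tendsD (tendsD a b) h0; rewrite !add0r; congr tends.
apply/funext => n; rewrite linearBl linearBr /=.
by rewrite addrA addrNK subrK.
Qed.

Lemma cdot_linearl (psi : K) : scalar (cdot^~ psi).
Proof.
move=> a phi phi'; have [u hu] := completionP phi; have [u' hu'] := completionP phi'.
have [v hv] := completionP psi.
have hl : represents (fun n => a *: u n + u' n) (a *: phi + phi' : K).
  exact: represents_lin.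
apply: tends_uniq (cdot_tends hl hv) _.
have h1 := cdot_tends hu hv; have h2 := cdot_tends hu' hv.
under eq_fun do rewrite linearPl.
apply: tendsD h2 => e e0; have k0 : 0 < rnorm a + 1 by have := rnorm_ge0 a; lra.
have [N h] := h1 _ (divr_gt0 e0 k0); exists N => n /h.
rewrite -mulrBr rnormM ltr_pdivlMr //; move: (rnorm_ge0 (f (u n) (v n) - cdot phi psi)).
by have := rnorm_ge0 a; nra.
Qed.

Lemma cdotC (phi psi : K) : cdot psi phi = conjC (cdot phi psi).
Proof.
have [u hu] := completionP phi; have [v hv] := completionP psi.
apply: tends_uniq (cdot_tends hv hu) _ => e /(cdot_tends hu hv)[N h].
by exists N => n /h; rewrite [f (v n) _]formC -conjCB rnormJ.
Qed.

Lemma cdot_bilinear : bilinear_for (GRing.Scale.Law.clone _ _ *%R _)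
  (GRing.Scale.Law.clone _ _ (conjC \; *%R) _) cdot.
Proof.
split=> [psi|phi]; first exact: cdot_linearl.
move=> a psi psi' /=; rewrite cdotC cdot_linearl rmorphD rmorphM /=.
by rewrite -!cdotC.
Qed.

HB.instance Definition _ := bilinear_isBilinear.Build R[i] K K R[i] _ _
  cdot cdot_bilinear.

Lemma cdot_hermitian (phi psi : K) :
  cdot phi psi = (-1) ^+ false * conjC (cdot psi phi).
Proof. by rewrite expr0 mul1r cdotC. Qed.

HB.instance Definition _ := isHermitianSesquilinear.Build R[i] K false conjC
  cdot cdot_hermitian.

Lemma cdot_sq_tends u (phi : K) : represents u phi ->
  forall e : R, 0 < e -> exists N, forall n, (N <= n)%N ->
    `|sqnorm f (u n) - Rez (cdot phi phi)| < e.
Proof.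
move=> hu e /(cdot_tends hu hu)[N h]; exists N => n /h; apply: le_lt_trans.
by rewrite /sqnorm -ReB Re_le_rnorm.
Qed.

Lemma cdot_ge0 (phi : K) : 0 <= cdot phi phi.
Proof.
have -> : cdot phi phi = toC (Rez (cdot phi phi)).
  have := cdotC phi phi; case: (cdot _ _) => a b [] /eqP.
  by rewrite -addr_eq0 -mulr2n mulrn_eq0 => /eqP ->.
rewrite lecR; have [u hu] := completionP phi.
rewrite leNgt; apply/negP => neg.
have := cdot_sq_tends hu (e := - Rez (cdot phi phi)).
rewrite oppr_gt0 => /(_ neg)[N /(_ N (leqnn N))].
by have := sqnorm_ge0 f_ge0 (u N); rewrite ltr_norml => h /andP[_]; lra.
Qed.

Lemma cdot_eq0 (phi : K) : cdot phi phi = 0 -> phi = 0.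
Proof.
move=> p0; have [u hu] := completionP phi; apply: completion_ext => y.
apply: tends_uniq (hu.2 y) _ => e e0.
have k0 : 0 < seminorm f y + 1 by have := seminorm_ge0 f y; lra.
have [N h] := cdot_sq_tends hu (exprn_gt0 2 (divr_gt0 e0 k0)).
exists N => n /h; rewrite p0 [X in rnorm (_ - X)](_ : _ = 0) // !subr0 => h1.
apply: le_lt_trans (form_CS f_ge0 _ _) _.
have h2 : seminorm f (u n) < e / (seminorm f y + 1).
  rewrite -(@ltr_pXn2r _ 2) ?nnegrE ?seminorm_ge0 ?(ltW (divr_gt0 _ _)) // seminorm_sqr //.
  exact: le_lt_trans (ler_norm _) h1.
move: h2; rewrite ltr_pdivlMr //.
by have := seminorm_ge0 f y; have := seminorm_ge0 f (u n); nra.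
Qed.

Lemma cdot_gt0 (phi : K) : phi != 0 -> 0 < cdot phi phi.
Proof.
by move=> p0; rewrite lt_def cdot_ge0 andbT; apply: contra_neq p0 => /cdot_eq0.
Qed.

HB.instance Definition _ := isDotProduct.Build R[i] K cdot cdot_gt0.

Definition cnorm (phi : K) : R[i] := toC (seminorm cdot phi).

Lemma cnormD phi psi : cnorm (phi + psi) <= cnorm phi + cnorm psi.
Proof. by rewrite /cnorm -rmorphD lecR (seminormD cdot_ge0). Qed.
Lemma cnormZ a phi : cnorm (a *: phi) = `|a| * cnorm phi.
Proof. by rewrite /cnorm (seminormZ cdot_ge0) rmorphM rnormE. Qed.
Lemma cnorm_eq0 phi : cnorm phi = 0 -> phi = 0.
Proof.
move=> [h]; apply: cdot_eq0; rewrite (sqnormE cdot_ge0) -(seminorm_sqr cdot_ge0) h.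
by rewrite expr0n.
Qed.

HB.instance Definition _ := Lmodule_isNormed.Build R[i] K cnormD cnormZ cnorm_eq0.

Lemma rnorm_cnorm (phi : K) : rnorm phi = seminorm cdot phi.
Proof. by []. Qed.

Lemma cembed_represents (x : D) : represents (fun=> x) (f x).
Proof. by split=> [|y]; [exact: semi_Cauchy_cst|exact: tends_cst]. Qed.

Lemma cembedP x : f x \in completion_pred.
Proof. by apply/asboolP; exists (fun=> x); apply: cembed_represents. Qed.

Definition cembed x : K := Completion (cembedP x).

Lemma cdot_cembed x y : cdot (cembed x) (cembed y) = f x y.
Proof.
have := cdot_tends (cembed_represents x : represents _ (cembed x))
  (cembed_represents y : represents _ (cembed y)).
move=> h; exact: tends_uniq h (tends_cst _).
Qed.

Lemma represents_sub u (phi : K) x : represents u phi ->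
  represents (fun m => u m - x) (phi - cembed x : K).
Proof.
move=> hu; have := represents_lin (-1) (cembed_represents x) hu.
congr represents; first by apply/funext => m; rewrite scaleN1r addrC.
by apply/funext => y; rewrite mulN1r addrC.
Qed.

Lemma represents_cvg u (phi : K) : represents u phi -> forall e : R, 0 < e ->
  exists N, forall n, (N <= n)%N -> rnorm (phi - cembed (u n)) < e.
Proof.
move=> hu e e0; have e2 : 0 < e / 2 by lra.
have [N hN] := hu.1 _ e2; exists N => n Nn.
rewrite rnorm_cnorm; apply: le_lt_trans (_ : e / 2 < e); last by lra.
rewrite -(@ler_pXn2r _ 2) ?nnegrE ?seminorm_ge0 ?(ltW e2) // (seminorm_sqr cdot_ge0).
apply/ler_addgt0Pr => d d0.
have [M hM] := cdot_sq_tends (represents_sub (u n) hu) d0.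
have {}hM := hM _ (leq_maxr N M); have {}hN := hN _ n (leq_maxl N M) Nn.
have : sqnorm f (u (maxn N M) - u n) <= (e / 2) ^+ 2.
  by rewrite -seminorm_sqr // ler_pXn2r ?nnegrE ?seminorm_ge0 ?(ltW e2) // ltW.
move: hM; rewrite ltr_norml => /andP[h _].
have {}h : - d < sqnorm f (u (maxn N M) - u n) - sqnorm cdot (phi - cembed (u n)) := h.
by lra.
Qed.

Lemma cembedB x y : cembed (x - y) = cembed x - cembed y :> K.
Proof. by apply: completion_ext => z; rewrite /= linearBl. Qed.

Lemma rnorm_cembed x : rnorm (cembed x : K) = seminorm f x.
Proof. by rewrite rnorm_cnorm; congr (Num.sqrt (Rez _)); apply: cdot_cembed. Qed.

Let lt_sum3 (p q r s t x y e : R) : p <= q + r -> r <= s + t -> q < x ->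
  t < y -> s < e / 3 -> x < e / 3 -> y < e / 3 -> p < e.
Proof. lra. Qed.
Let lt_sum2 (p q r x e : R) : p <= q + r -> q < x -> x < e / 2 -> r < e / 2 ->
  p < e.
Proof. lra. Qed.

(** Approximate each [phi k] to within [1 / (k + 1)] by an element of [D]; these
    elements form a Cauchy sequence whose functional is the limit. *)
Lemma completion_Cauchy (phi : nat -> K) : Cauchy phi -> exists l, tends phi l.
Proof.
move=> cp.
have dense k : exists x : D, rnorm (phi k - cembed x) < k.+1%:R^-1.
  have [u hu] := completionP (phi k).
  have k0 : 0 < k.+1%:R^-1 :> R by rewrite invr_gt0 ltr0Sn.
  have [N hN] := represents_cvg hu k0.
  by exists (u N); apply: hN.
have [u hu] := boolp.choice dense.
have cu : semi_Cauchy u.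
  move=> e e0; have e3 : 0 < e / 3 by lra.
  have [N1 h1] := cp _ e3; have [N2 h2] := inv_nat_small e3.
  exists (maxn N1 N2) => m n; rewrite !geq_max => /andP[m1 m2] /andP[n1 n2].
  rewrite -rnorm_cembed cembedB.
  have a := rnorm_tri (phi m) (cembed (u m) : K) (cembed (u n)).
  have b := rnorm_tri (phi n) (phi m) (cembed (u n)).
  rewrite (rnormC (cembed (u m)) (phi m)) in a.
  exact: (lt_sum3 a b (hu m) (hu n) (h1 m n m1 n1) (h2 m m2) (h2 n n2)).
have lim y : exists l, tends (fun n => f (u n) y) l.
  exact/Cauchy_complex/(form_Cauchy cu (semi_Cauchy_cst y)).
have [psi hpsi] := boolp.choice lim.
have psiP : psi \in completion_pred by apply/asboolP; exists u.
have rep : represents u (Completion psiP) by [].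
exists (Completion psiP) => e e0; have e2 : 0 < e / 2 by lra.
have [N1 h1] := represents_cvg rep e2; have [N2 h2] := inv_nat_small e2.
exists (maxn N1 N2) => n; rewrite geq_max => /andP[/h1 a /h2 b].
have c := rnorm_tri (cembed (u n) : K) (phi n) (Completion psiP).
rewrite (rnormC (cembed (u n)) (Completion psiP)) in c.
exact: (lt_sum2 c (hu n) b a).
Qed.

HB.instance Definition _ := Uniform_isComplete.Build K (Cauchy_cvg completion_Cauchy).

Lemma cdot_norm (phi : K) : cdot phi phi = `|phi| ^+ 2.
Proof.
by rewrite (sqnormE cdot_ge0) -(seminorm_sqr cdot_ge0) -rnorm_cnorm rnormE rmorphXn.
Qed.

HB.instance Definition _ := CompleteNormedModule_isHilbert.Build R K cdot_norm.

Section Operator.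
Variables (A E : D -> D).
Hypothesis AB : {morph A : x y / x - y}.
Hypothesis AE : forall x y, f (A x) y = f x (E y).
Hypothesis A_le : forall x, seminorm f (A x) <= seminorm f x.

Lemma represents_op u (phi : K) : represents u phi ->
  represents (fun n => A (u n)) (fun y => phi (E y)).
Proof.
move=> [cu hu]; split=> [e e0|y]; last by under eq_fun do rewrite AE; apply: hu.
have [N h] := cu _ e0; exists N => m n m1 n1; rewrite -AB.
exact: le_lt_trans (A_le _) (h _ _ m1 n1).
Qed.

Lemma extend_op_subproof (phi : K) : (fun y => phi (E y)) \in completion_pred.
Proof.
have [u hu] := completionP phi; apply/asboolP; exists (fun n => A (u n)).
exact: represents_op.
Qed.

(** On functionals, the extension of [A] is composition with its formal adjoint
    [E]. *)
Lemma extend_op : exists N : 'B(K), forall phi y, N phi y = phi (E y).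
Proof.
pose g (phi : K) : K := Completion (extend_op_subproof phi).
have [] := @mk_bop _ K g 1.
- by move=> a phi psi; apply: completion_ext.
- move=> phi; rewrite mul1r !rnorm_cnorm; have [u hu] := completionP phi.
  have hg : represents (fun n => A (u n)) (g phi) by apply: represents_op.
  rewrite -(@ler_pXn2r _ 2) ?nnegrE ?seminorm_ge0 // !(seminorm_sqr cdot_ge0).
  apply/ler_addgt0Pr => e e0; have e2 : 0 < e / 2 by lra.
  have [N1 h1] := cdot_sq_tends hu e2; have [N2 h2] := cdot_sq_tends hg e2.
  have {}h1 := h1 _ (leq_maxl N1 N2); have {}h2 := h2 _ (leq_maxr N1 N2).
  have h3 : sqnorm f (A (u (maxn N1 N2))) <= sqnorm f (u (maxn N1 N2)).
    by rewrite -!seminorm_sqr // ler_pXn2r ?nnegrE ?seminorm_ge0.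
  move: h1 h2; rewrite !ltr_norml => /andP[_ h1] /andP[h2 _].
  have {}h1 : sqnorm f (u (maxn N1 N2)) - sqnorm cdot phi < e / 2 := h1.
  have {}h2 : - (e / 2) < sqnorm f (A (u (maxn N1 N2))) - sqnorm cdot (g phi) := h2.
  move: h1 h2 h3; move: (sqnorm cdot phi) (sqnorm cdot (g phi)) (sqnorm f _) (sqnorm f _).
  by move=> a b c d; lra.
by move=> N hN; exists N => phi y; rewrite hN.
Qed.
End Operator.

Lemma extend_op_adj (A E : D -> D) (N N' : 'B(K)) :
  {morph A : x y / x - y} -> {morph E : x y / x - y} ->
  (forall x y, f (A x) y = f x (E y)) ->
  (forall x, seminorm f (A x) <= seminorm f x) ->
  (forall x, seminorm f (E x) <= seminorm f x) ->
  (forall (phi : K) y, N phi y = phi (E y)) ->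
  (forall (phi : K) y, N' phi y = phi (A y)) ->
  adj N = N'.
Proof.
move=> AB EB AE A_le E_le NE NA; apply: adj_unique => phi psi.
have EA x y : f (E x) y = f x (A y) by rewrite formC -AE -formC.
have [u hu] := completionP phi; have [v hv] := completionP psi.
have h1 : represents (fun n => A (u n)) (N phi).
  by rewrite (funext (NE phi)); apply: represents_op.
have h2 : represents (fun n => E (v n)) (N' psi).
  by rewrite (funext (NA psi)); apply: represents_op.
apply: tends_uniq (cdot_tends h1 hv) _.
by under eq_fun do rewrite AE; apply: cdot_tends.
Qed.
End SemiNormSequences.

(** * Boundedness of formally normal maps *)

Section NormalContraction.
Context {R : realType} {D : lmodType R[i]}.
Variable (f : {hermitian D for false & conjC}).
Hypothesis f_ge0 : forall x, 0 <= f x x.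
Variables (A E : D -> D).
Hypothesis AB : {morph A : x y / x - y}.
Hypothesis AE : forall x y, f (A x) y = f x (E y).
Hypothesis AEC : forall x, A (E x) = E (A x).

(** [|E x| = |A x|]: a formally normal map and its formal adjoint have the same
    semi-norm. *)
Lemma sqnorm_normal x : sqnorm f (E x) = sqnorm f (A x).
Proof. by rewrite /sqnorm -AE AEC formC -AE ReJ. Qed.

Lemma convex_bounded_le (a : nat -> R) C :
  (forall n, 0 <= a n - 2 * a n.+1 + a n.+2) -> (forall n, a n <= C) ->
  a 1%N <= a 0%N.
Proof.
move=> conv aC; rewrite -subr_le0; apply: (@nat_mul_bounded _ _ (C - a 0%N)) => n.
have incr k : a 1%N - a 0%N <= a k.+1 - a k.
  by elim: k => [|k IH] //; have := conv k; lra.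
have : n%:R * (a 1%N - a 0%N) <= a n - a 0%N.
  elim: n => [|n IH]; first by rewrite mul0r subrr.
  by rewrite mulrSr; have := incr n; lra.
by have := aC n; lra.
Qed.

(** [|A^n x|^2] is convex in [n], as its second difference is the square of the
    semi-norm of [A^n (1 - E A) x].  A bounded convex sequence is
    nonincreasing. *)
Lemma power_bounded_contraction x C : (forall n, sqnorm f (iter n A x) <= C) ->
  seminorm f (A x) <= seminorm f x.
Proof.
move=> bnd; rewrite ler_wsqrtr //.
apply: (@convex_bounded_le (fun n => sqnorm f (iter n A x)) C) => // n /=.
set y := iter n A x; have := sqnorm_ge0 f_ge0 (y - E (A y)).
by rewrite sqnormB sqnorm_normal -AE -/(sqnorm f (A y)); lra.
Qed.
End NormalContraction.

(** * Finitely supported functions and the Bram-Halmos criterion *)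

Section FiniteSupport.
Context {R : realType} {H : hilbertType R} {I : choiceType}.

Definition fsupp_pred : {pred (I -> H)} :=
  fun h => `[< exists r : seq I, forall p, p \notin r -> h p = 0 >].

Lemma fsupp_closed : submod_closed fsupp_pred.
Proof.
split=> [|a h g /asboolP[r hr] /asboolP[s gs]]; apply/asboolP; first by exists [::].
exists (r ++ s) => p; rewrite mem_cat negb_or => /andP[pr ps].
by rewrite -[LHS]/(a *: h p + g p) hr // gs // scaler0 addr0.
Qed.

HB.instance Definition _ := GRing.isSubmodClosed.Build _ _ fsupp_pred fsupp_closed.

Record fin_fun := FinFun { fsval :> I -> H; fsvalP : fsval \in fsupp_pred }.

HB.instance Definition _ := [isSub of fin_fun for fsval].
HB.instance Definition _ := [Choice of fin_fun by <:].
HB.instance Definition _ := [SubChoice_isSubLmodule of fin_fun by <:].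

Lemma fs_ext (h g : fin_fun) : (forall p, h p = g p) -> h = g.
Proof. by move=> hg; apply: val_inj; apply/funext. Qed.
Lemma fsPE a (h g : fin_fun) p : (a *: h + g) p = a *: h p + g p. Proof. by []. Qed.
Lemma supp_ex (h : fin_fun) : exists r : seq I, uniq r /\ forall p, p \notin r -> h p = 0.
Proof.
have /asboolP[r hr] := fsvalP h; exists (undup r); split; first exact: undup_uniq.
by move=> p; rewrite mem_undup; apply: hr.
Qed.
Definition supp (h : fin_fun) : seq I := projT1 (cid (supp_ex h)).
Lemma supp_uniq h : uniq (supp h). Proof. by case: (projT2 (cid (supp_ex h))). Qed.
Lemma supp0 h p : p \notin supp h -> h p = 0.
Proof. by case: (projT2 (cid (supp_ex h))) => _; apply. Qed.

(** Independence of the list of indices chosen to sum a finitely supported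
    family; it makes [bram_form] computable on any lists that cover the
    supports ([bram_formE]). *)
Lemma big_supp (V : nmodType) (F : I -> V) (r s : seq I) : uniq r -> uniq s ->
  (forall p, p \notin r -> F p = 0) -> (forall p, p \notin s -> F p = 0) ->
  \sum_(p <- r) F p = \sum_(p <- s) F p.
Proof.
move=> ur us hr hs.
have flt (t : seq I) : \sum_(p <- t) F p = \sum_(p <- [seq p <- t | F p != 0]) F p.
  by rewrite big_filter [RHS]big_mkcond; apply: eq_bigr => p _; case: eqP.
rewrite flt [RHS]flt; apply: perm_big; apply: uniq_perm; rewrite ?filter_uniq //.
move=> p; rewrite !mem_filter; case: (boolP (F p == 0)) => //= F0.
by rewrite (contra_neqT (hr p) F0) (contra_neqT (hs p) F0).
Qed.

Variable W : I -> 'B(H).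

(** If [N_p] is the normal extension of [W p] and [h] stands for the sum of
    [adj N_q (h q)], this is the inner product of the vectors that [h] and [g]
    stand for. *)
Definition bram_form (h g : fin_fun) : R[i] :=
  \sum_(p <- supp g) \sum_(q <- supp h) ip (W p (h q)) (W q (g p)).

Lemma bram_formE (h g : fin_fun) (r s : seq I) : uniq r -> uniq s ->
  (forall p, p \notin r -> g p = 0) -> (forall p, p \notin s -> h p = 0) ->
  bram_form h g = \sum_(p <- r) \sum_(q <- s) ip (W p (h q)) (W q (g p)).
Proof.
move=> ur us gr hs.
transitivity (\sum_(p <- r) \sum_(q <- supp h) ip (W p (h q)) (W q (g p))).
  apply: big_supp => //; first exact: supp_uniq.
    by move=> p /supp0 ->; rewrite big1 // => q _; rewrite linear0 ip0r.
  by move=> p /gr ->; rewrite big1 // => q _; rewrite linear0 ip0r.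
apply: eq_bigr => p _; apply: big_supp => //; first exact: supp_uniq.
  by move=> q /supp0 ->; rewrite linear0 ip0l.
by move=> q /hs ->; rewrite linear0 ip0l.
Qed.

Lemma bram_form_linearl (g : fin_fun) : scalar (bram_form^~ g).
Proof.
move=> a h h'; set r := undup (supp (a *: h + h') ++ supp h ++ supp h').
have ur : uniq r by apply: undup_uniq.
have E (x : fin_fun) : {subset supp x <= r} -> bram_form x g =
    \sum_(p <- supp g) \sum_(q <- r) ip (W p (x q)) (W q (g p)).
  move=> xr; apply: bram_formE (supp_uniq g) ur (@supp0 g) _ => p.
  by move=> pr; apply: supp0; apply: contra pr => /xr.
rewrite !E; first last.
- by move=> p pr; rewrite mem_undup !mem_cat pr.
- by move=> p pr; rewrite mem_undup !mem_cat pr ?orbT.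
- by move=> p pr; rewrite mem_undup !mem_cat pr ?orbT.
rewrite mulr_sumr -big_split; apply: eq_bigr => p _ /=.
rewrite mulr_sumr -big_split; apply: eq_bigr => q _ /=.
rewrite -[LHS]/(ip (W p (a *: h q + h' q)) (W q (g p))).
by rewrite linearP ipDl ipZl.
Qed.

Lemma bram_formC h g : bram_form g h = conjC (bram_form h g).
Proof.
rewrite /bram_form exchange_big rmorph_sum; apply: eq_bigr => p _ /=.
by rewrite rmorph_sum; apply: eq_bigr => q _ /=; rewrite ipC.
Qed.

Lemma bram_bilinear : bilinear_for (GRing.Scale.Law.clone _ _ *%R _)
  (GRing.Scale.Law.clone _ _ (conjC \; *%R) _) bram_form.
Proof.
split=> [g|h]; first exact: bram_form_linearl.
move=> a g g' /=; rewrite bram_formC bram_form_linearl rmorphD rmorphM /=.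
by rewrite -!bram_formC.
Qed.

HB.instance Definition _ := bilinear_isBilinear.Build R[i] fin_fun fin_fun R[i] _ _
  bram_form bram_bilinear.

Lemma bram_hermitian (h g : fin_fun) :
  bram_form h g = (-1) ^+ false * conjC (bram_form g h).
Proof. by rewrite expr0 mul1r bram_formC. Qed.

HB.instance Definition _ := isHermitianSesquilinear.Build R[i] fin_fun false conjC
  bram_form bram_hermitian.

Hypothesis W_psd : forall (r : seq I) (h : I -> H),
  0 <= \sum_(p <- r) \sum_(q <- r) ip (W p (h q)) (W q (h p)).

Lemma bram_form_ge0 h : 0 <= bram_form h h.
Proof. exact: W_psd. Qed.

Section Shift.
Variables (S : 'B(H)) (s : I -> I) (t : I -> option I).
Hypothesis sK : pcancel s t.
Hypothesis tK : ocancel t s.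
Hypothesis WS : forall p, W (s p) = W p * S.
Hypothesis W_le : forall p x, rnorm (W p x) <= rnorm x.
Hypothesis S_le : forall x, rnorm (S x) <= rnorm x.

Lemma map_fsP (h : fin_fun) : (fun p => S (h p)) \in fsupp_pred.
Proof. by apply/asboolP; exists (supp h) => p /supp0 ->; rewrite linear0. Qed.
Definition fsmap h := FinFun (map_fsP h).

Lemma shift_supp (g : fin_fun) p : p \notin map s (supp g) -> oapp g 0 (t p) = 0.
Proof.
have := tK p; case: (t p) => //= q sqp pn; apply: supp0.
by apply: contra pn => qg; rewrite -sqp map_f.
Qed.
Lemma shift_fsP (g : fin_fun) : (fun p => oapp g 0 (t p)) \in fsupp_pred.
Proof. by apply/asboolP; exists (map s (supp g)); apply: shift_supp. Qed.

(** The adjoint of the extension of [S] reindexes by [s]; [t] is the partial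
    inverse of [s]. *)
Definition fsshift g := FinFun (shift_fsP g).

Lemma fsmapB : {morph fsmap : h g / h - g}.
Proof. by move=> h g; apply: fs_ext => p; rewrite /= linearB. Qed.
Lemma fsshiftB : {morph fsshift : h g / h - g}.
Proof.
move=> h g; apply: fs_ext => p.
rewrite -[RHS]/(oapp h 0 (t p) - oapp g 0 (t p)) /=.
by case: (t p) => //=; rewrite subrr.
Qed.

Lemma fsmap_shift h : fsmap (fsshift h) = fsshift (fsmap h).
Proof. by apply: fs_ext => p /=; case: (t p) => //=; rewrite linear0. Qed.

Lemma fsmap_adj h g : bram_form (fsmap h) g = bram_form h (fsshift g).
Proof.
rewrite (@bram_formE (fsmap h) g (supp g) (supp h)) ?supp_uniq //; first last.
- by move=> p /supp0 /= ->; rewrite linear0.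
- exact: supp0.
rewrite (@bram_formE h (fsshift g) (map s (supp g)) (supp h)) ?supp_uniq //;
  first last.
- exact: supp0.
- exact: shift_supp.
- by rewrite map_inj_uniq ?supp_uniq //; apply: pcan_inj sK.
rewrite big_map; apply: eq_bigr => p _; apply: eq_bigr => q _.
by rewrite /= sK /= WS.
Qed.

Lemma iter_fsmap n h p : iter n fsmap h p = iter n S (h p).
Proof. by elim: n => [|n IH] //=; rewrite IH. Qed.

Lemma iter_contract n x : rnorm (iter n S x) <= rnorm x.
Proof. by elim: n => [|n IH] //=; apply: le_trans (S_le _) IH. Qed.

(** As [S] and the [W p] are contractions, the powers of [fsmap] stay bounded on
    each [h], although with a bound that depends on more than the semi-norm of
    [h]. *)
Lemma fsmap_bounded h n : sqnorm bram_form (iter n fsmap h) <=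
  \sum_(p <- supp h) \sum_(q <- supp h) rnorm (h q) * rnorm (h p).
Proof.
rewrite /sqnorm -[X in Rez X]/(bram_form (iter n fsmap h) (iter n fsmap h)).
have i0 : iter n S 0 = 0 by elim: n => [|n IH] //=; rewrite IH linear0.
rewrite (@bram_formE _ _ (supp h) (supp h)) ?supp_uniq //;
  try (by move=> p /supp0 hp; rewrite iter_fsmap hp).
have ReS (r : seq I) (F : I -> R[i]) : Rez (\sum_(p <- r) F p) = \sum_(p <- r) Rez (F p).
  by elim/big_rec2: _ => [|p a b _ <-] //; rewrite ReD.
rewrite ReS; apply: ler_sum => p _; rewrite ReS; apply: ler_sum => q _.
apply: le_trans (ler_norm _) _; apply: le_trans (Re_le_rnorm _) _.
apply: le_trans (ip_CS _ _) _; rewrite !iter_fsmap.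
by rewrite ler_pM ?rnorm_ge0 // (le_trans (W_le _ _)) ?iter_contract.
Qed.

Lemma fsmap_le h : seminorm bram_form (fsmap h) <= seminorm bram_form h.
Proof.
exact: (power_bounded_contraction bram_form_ge0 fsmap_adj fsmap_shift
  (fsmap_bounded h)).
Qed.

Lemma fsshift_le h : seminorm bram_form (fsshift h) <= seminorm bram_form h.
Proof.
apply: le_trans (fsmap_le h); rewrite /seminorm.
by rewrite (@sqnorm_normal _ _ bram_form fsmap fsshift fsmap_adj fsmap_shift).
Qed.
End Shift.
End FiniteSupport.

Section JointlySubnormal.
Context {R : realType} {H : hilbertType R}.
Variable S : 'I_2 -> 'B(H).
Hypothesis SC : forall i j, S i * S j = S j * S i.
Hypothesis S_le : forall i x, rnorm (S i x) <= rnorm x.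

Definition monomial (p : nat * nat) := S ord0 ^+ p.1 * S ord_max ^+ p.2.

Hypothesis S_psd : forall (r : seq (nat * nat)) (h : nat * nat -> H),
  0 <= \sum_(p <- r) \sum_(q <- r) ip (monomial p (h q)) (monomial q (h p)).

Definition incr_index (j : 'I_2) (p : nat * nat) :=
  if j == ord0 then (p.1.+1, p.2) else (p.1, p.2.+1).
Definition decr_index (j : 'I_2) (p : nat * nat) : option (nat * nat) :=
  match j == ord0, p with
  | true, (a.+1, b) => Some (a, b)
  | false, (a, b.+1) => Some (a, b)
  | _, _ => None
  end.

Lemma incr_indexK j : pcancel (incr_index j) (decr_index j).
Proof. by move=> [a b]; rewrite /decr_index /incr_index; case: (j == ord0). Qed.
Lemma decr_indexK j : ocancel (decr_index j) (incr_index j).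
Proof. by move=> [[|a] [|b]]; rewrite /decr_index /incr_index; case: (j == ord0). Qed.
Lemma decr_indexC (p : nat * nat) :
  obind (decr_index ord0) (decr_index ord_max p) =
  obind (decr_index ord_max) (decr_index ord0 p).
Proof. by case: p => [[|a] [|b]]. Qed.

Lemma ord2P (j : 'I_2) : j = if j == ord0 then ord0 else ord_max.
Proof. by apply: val_inj; case: j => [[|[|?]]]. Qed.

Lemma monomial_incr j p : monomial (incr_index j p) = monomial p * S j.
Proof.
rewrite /incr_index [in RHS](ord2P j); case: (j == ord0); rewrite /monomial /=.
  by rewrite -mulrA -(commrX _ (SC ord0 ord_max)) mulrA -exprSr.
by rewrite -mulrA -exprSr.
Qed.

Lemma monomial_le p x : rnorm (monomial p x) <= rnorm x.
Proof. by apply: le_trans (contractiveX _ (S_le _) _) (contractiveX _ (S_le _) _). Qed.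

Notation D := (@fin_fun R H (nat * nat)%type).
Let form0 := bram_form_ge0 S_psd.
Notation K := (completion form0).

Lemma delta_fsP x : (fun p => if p == (0, 0)%N then x else 0) \in
  @fsupp_pred R H (nat * nat)%type.
Proof.
apply/asboolP; exists [:: (0, 0)%N] => p.
by rewrite inE => /negPf ->.
Qed.
Definition delta x : D := FinFun (delta_fsP x).

Lemma bram_form_delta x y : bram_form monomial (delta x) (delta y) = ip x y.
Proof.
rewrite (@bram_formE _ _ _ monomial _ _ [:: (0, 0)%N] [:: (0, 0)%N]) //=; first last.
- by move=> p; rewrite inE => /negPf ->.
- by move=> p; rewrite inE => /negPf ->.
by rewrite !big_seq1.
Qed.

(** The extension acts on the completion of the finitely supported functions on
    [nat * nat]; the space embeds in it as the functions supported at [(0, 0)]. *)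
Lemma Bram_Halmos : jointly_subnormal S.
Proof.
split; first exact: SC.
have adjS j x y : bram_form monomial (fsmap (S j) x) y =
    bram_form monomial x (fsshift (decr_indexK j) y).
  exact: (fsmap_adj (incr_indexK j) (decr_indexK j) (monomial_incr j)).
have adjE j x y : bram_form monomial (fsshift (decr_indexK j) x) y =
    bram_form monomial x (fsmap (S j) y).
  by rewrite bram_formC -adjS -bram_formC.
have leS j x : seminorm (bram_form monomial) (fsmap (S j) x) <=
      seminorm (bram_form monomial) x.
  exact: (fsmap_le S_psd (incr_indexK j) (decr_indexK j) (monomial_incr j)
    monomial_le (S_le j)).
have leE j x : seminorm (bram_form monomial) (fsshift (decr_indexK j) x) <=
      seminorm (bram_form monomial) x.
  exact: (fsshift_le S_psd (incr_indexK j) (decr_indexK j) (monomial_incr j)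
    monomial_le (S_le j)).
have extM j : exists N : 'B(K), forall (phi : K) y,
    N phi y = phi (fsshift (decr_indexK j) y).
  exact: (extend_op form0 (@fsmapB _ _ _ (S j)) (adjS j) (leS j)).
have extS j : exists N : 'B(K), forall (phi : K) y, N phi y = phi (fsmap (S j) y).
  exact: (extend_op form0 (@fsshiftB _ _ _ _ _ (decr_indexK j)) (adjE j) (leE j)).
have [N NE] := boolp.choice extM; have [N' N'E] := boolp.choice extS.
have adjN j : adj (N j) = N' j.
  exact: (extend_op_adj (@fsmapB _ _ _ (S j)) (@fsshiftB _ _ _ _ _ (decr_indexK j))
    (adjS j) (leS j) (leE j) (NE j) (N'E j)).
have VL : linear (fun x => cembed form0 (delta x)).
  move=> a x y; apply: completion_ext => z.
  have -> : delta (a *: x + y) = a *: delta x + delta y.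
    apply: fs_ext => p; rewrite [RHS]fsPE /=.
    by case: (p == _); rewrite ?scaler0 ?addr0.
  exact: bram_form_linearl.
pose mx := GRing.isLinear.Build _ _ _ _ _ VL.
pose V : {linear H -> K} := HB.pack (fun x => cembed form0 (delta x)) mx.
exists K, V, N; split.
- move=> x y; rewrite -[LHS]/(cdot _ _) cdot_cembed; exact: bram_form_delta.
- apply: bopP => phi; apply: completion_ext => y /=.
  rewrite !NE; congr (cfun phi _); apply: fs_ext => p /=.
  have bind (A : nat * nat -> option (nat * nat)) o :
      oapp (fun q => oapp y 0 (A q)) 0 o = oapp y 0 (obind A o) by case: o.
  by rewrite !bind decr_indexC.
- move=> j; rewrite /normal_op adjN; apply: bopP => phi; apply: completion_ext => y /=.
  by rewrite NE N'E N'E NE fsmap_shift.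
- move=> j x; apply: completion_ext => y; rewrite NE /= -adjS.
  congr (bram_form monomial _ y); apply: fs_ext => p /=.
  by case: ifP; rewrite ?linear0.
Qed.
End JointlySubnormal.

(** * The operator identities of a left-inverse commuting toral 2-isometry *)

Section Pair.
Context {R : realType} {H : hilbertType R}.
Variable T : 'I_2 -> 'B(H).
Hypothesis Tcomm : forall i j, T i * T j = T j * T i.
Hypothesis Tlinv : forall i, left_invertible (T i).
Hypothesis Tlic : forall i j, i != j ->
  left_inv_op (T i) * T j = T j * left_inv_op (T i).
Hypothesis Ttoral : forall i j, 1 - adj (T i) * T i - adj (T j) * T j
              + adj (T j) * adj (T i) * T i * T j = 0.
Hypothesis Tker : forall i,
  (adj (T i) * T i) @` ker_op (adj (T i)) `<=` ker_op (adj (T i)).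

(** The operators of the pair are locked, so that rewriting with the ring laws
    treats them as atoms and does not look into their definitions. *)
Definition gram i := locked (adj (T i) * T i).
Definition gram_inv i := locked (inv_op (adj (T i) * T i)).
Definition defect i := locked (adj (T i) * T i - 1).
Definition dual i := locked (cauchy_dual (T i)).

(** The orthogonal projection onto the range of [T i]. *)
Definition range_proj i := locked (T i * adj (dual i)).

Local Notation Q := gram.
Local Notation V := gram_inv.
Local Notation B := defect.
Local Notation S := dual.
Local Notation P := range_proj.

Lemma gramE i : Q i = adj (T i) * T i. Proof. by rewrite /gram -lock. Qed.
Lemma gram_invE i : V i = inv_op (Q i).
Proof. by rewrite gramE /gram_inv -lock. Qed.
Lemma defectE i : B i = Q i - 1. Proof. by rewrite gramE /defect -lock. Qed.
Lemma dualE i : S i = T i * V i.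
Proof. by rewrite gram_invE gramE /dual -lock. Qed.
Lemma range_projEl i : P i = T i * adj (S i).
Proof. by rewrite /range_proj -lock. Qed.

Lemma gramV i : Q i * V i = 1.
Proof. by rewrite gram_invE gramE; have [] := inv_opP (Tlinv i). Qed.
Lemma Vgram i : V i * Q i = 1.
Proof. by rewrite gram_invE gramE; have [] := inv_opP (Tlinv i). Qed.
Lemma adj_gram i : adj (Q i) = Q i.
Proof. by rewrite gramE adjM adjK. Qed.
Lemma adj_V i : adj (V i) = V i.
Proof.
rewrite -[LHS]mulr1 -(gramV i) mulrA -{1}(adj_gram i) -adjM gramV adj1.
by rewrite mul1r.
Qed.
Lemma adj_defect i : adj (B i) = B i.
Proof. by rewrite defectE adjB adj1 adj_gram. Qed.
Lemma adj_dualE i : adj (S i) = V i * adj (T i).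
Proof. by rewrite dualE adjM adj_V. Qed.
Lemma dual_gram i : S i * Q i = T i.
Proof. by rewrite dualE -mulrA Vgram mulr1. Qed.
Lemma gram_dual i : Q i * adj (S i) = adj (T i).
Proof. by rewrite adj_dualE mulrA gramV mul1r. Qed.
Lemma adjT_dual i : adj (T i) * S i = 1.
Proof. by rewrite dualE mulrA -gramE gramV. Qed.
Lemma range_projE i : P i = S i * adj (T i).
Proof. by rewrite range_projEl -{1}(dual_gram i) -mulrA gram_dual. Qed.
Lemma adj_range_proj i : adj (P i) = P i.
Proof. by rewrite range_projE adjM adjK -range_projEl range_projE. Qed.
Lemma adjT_range_proj i : adj (T i) * P i = adj (T i).
Proof. by rewrite range_projE mulrA adjT_dual mul1r. Qed.

(** The kernel condition, applied to the vectors [(1 - P i) x] of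
    [ker (adj (T i))]. *)
Lemma adjT_gram_proj i : adj (T i) * Q i = adj (T i) * Q i * P i.
Proof.
apply/eqP; rewrite -subr_eq0 -{1}[adj _ * Q i]mulr1 -mulrBr; apply/eqP/bopP => x.
have e : ker_op (adj (T i)) ((1 - P i) x).
  suff h : (adj (T i) * (1 - P i)) x = 0 by exact: h.
  by rewrite mulrBr mulr1 adjT_range_proj subrr.
by have := @Tker i (Q i ((1 - P i) x)); apply; exists ((1 - P i) x); rewrite // gramE.
Qed.

Lemma toralE i j : adj (T j) * (Q i * T j) = Q i + Q j - 1.
Proof.
apply/eqP; rewrite -subr_eq0 -(Ttoral i j) !gramE !mulrA; apply/eqP.
by rewrite opprB opprD !addrA [RHS]addrC !addrA [adj (T j) * _ * _ * _ + 1]addrC.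
Qed.

(** By the kernel condition [Q i * T i] has its range in that of [T i], so it is
    determined by [adj (T i) * Q i * T i], which the toral identity computes. *)
Lemma gramT_same i : Q i * T i = S i * (Q i + Q i - 1).
Proof.
have -> : Q i * T i = P i * (Q i * T i).
  have := congr1 adj (adjT_gram_proj i).
  by rewrite !adjM adj_range_proj adj_gram adjK.
by rewrite range_projE -mulrA toralE.
Qed.

Lemma left_inv_opE i : left_inv_op (T i) = adj (S i).
Proof. by rewrite adj_dualE gram_invE gramE. Qed.

Lemma adjT_dualC i j : i != j -> adj (T j) * S i = S i * adj (T j).
Proof.
move=> ij; have := congr1 adj (esym (Tlic ij)).
by rewrite left_inv_opE !adjM !adjK.
Qed.

(** Here [Q j * T i = adj (T j) * T i * T j] has its range in that of [S i]
    because [adj (T j)] commutes with [S i]. *)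
Lemma gramT_cross i j : i != j -> Q j * T i = S i * (Q i + Q j - 1).
Proof.
move=> ij; rewrite -toralE (gramE j) -mulrA (Tcomm j i).
by rewrite -{1}(dual_gram i) !mulrA adjT_dualC.
Qed.

(** The identity behind everything that follows; the case [i = j] expresses the
    2-isometry together with the kernel condition, the case [i != j] the mixed
    toral identity together with left-inverse commutation. *)
Lemma defectT i j : B j * T i = S i * B j.
Proof.
have h : Q j * T i = S i * (Q i + Q j - 1).
  have [->|ij] := eqVneq i j; [exact: gramT_same|exact: gramT_cross].
rewrite !defectE mulrBl mul1r h -{1}(dual_gram i) -mulrBr; congr (_ * _).
by rewrite addrAC [Q i + _]addrC addrK.
Qed.

Lemma dual_defect1 i : S i * (1 + B i) = T i.
Proof. by rewrite defectE addrC subrK dual_gram. Qed.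

Definition weight i j n m := 1 + B i *+ n + B j *+ m.

Lemma weightC i j n m : weight i j n m = weight j i m n.
Proof. by rewrite /weight addrAC. Qed.
Lemma weight00 i j : weight i j 0 0 = 1.
Proof. by rewrite /weight !mulr0n !addr0. Qed.
Lemma adj_weight i j n m : adj (weight i j n m) = weight i j n m.
Proof. by rewrite /weight !adjD !adjMn !adj_defect adj1. Qed.

(** [c(n, m) T_i = T_i + n S_i B_i + m S_i B_j] by [defectT], and
    [T_i = S_i (1 + B_i)]. *)
Lemma dual_weight i j n m : S i * weight i j n.+1 m = weight i j n m * T i.
Proof.
rewrite /weight mulrS addrA !mulrDr !mulrDl mul1r !mulrnAr !mulrnAl !defectT.
by rewrite -{1}(dual_defect1 i) mulrDr mulr1.
Qed.

Lemma dualX_weight i j k n m : S i ^+ k * weight i j (k + n) m = weight i j n m * T i ^+ k.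
Proof.
elim: k n => [|k IH] n; first by rewrite !expr0 mulr1 mul1r.
by rewrite !exprSr addSn -mulrA dual_weight mulrA IH mulrA.
Qed.

(** The inverse of [weight i j n m], written as the Gram operator of the powers of
    the dual pair. *)
Definition weight_inv i j n m := adj (S i ^+ n * S j ^+ m) * (S i ^+ n * S j ^+ m).

Lemma dual2_weight i j n m :
  S i ^+ n * S j ^+ m * weight i j n m = T i ^+ n * T j ^+ m.
Proof.
have h := dualX_weight j i m 0 n; have h' := dualX_weight i j n 0 0.
rewrite addn0 in h; rewrite addn0 weight00 mul1r in h'.
by rewrite -mulrA weightC h mulrA [weight j i _ _]weightC h'.
Qed.

Lemma adjT_dualX i n : adj (T i) ^+ n * S i ^+ n = 1.
Proof.
elim: n => [|n IH]; first by rewrite !expr0 mulr1.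
by rewrite exprSr exprS mulrA -(mulrA _ _ (S i)) adjT_dual mulr1.
Qed.

Lemma adjT_dual2 i j n m :
  adj (T i ^+ n * T j ^+ m) * (S i ^+ n * S j ^+ m) = 1.
Proof.
by rewrite adjM !adjX mulrA -(mulrA _ _ (S i ^+ n)) adjT_dualX mulr1 adjT_dualX.
Qed.

Lemma weightV i j n m : weight i j n m * weight_inv i j n m = 1.
Proof.
rewrite /weight_inv mulrA -(adj_weight i j n m) -adjM dual2_weight; exact: adjT_dual2.
Qed.
Lemma Vweight i j n m : weight_inv i j n m * weight i j n m = 1.
Proof.
have := congr1 adj (weightV i j n m).
by rewrite adjM adj_weight adj1 /weight_inv adjM adjK.
Qed.

(** Both products, multiplied by the invertible [weight i j 1 1], give
    [T i * T j]. *)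
Lemma dual_commute i j : S i * S j = S j * S i.
Proof.
have e i' j' : S i' * S j' * weight i' j' 1 1 = T i' * T j'.
  by have := dual2_weight i' j' 1 1; rewrite !expr1.
rewrite -[S i * S j]mulr1 -(weightV i j 1 1) mulrA e Tcomm -e weightC -mulrA.
by rewrite weightV mulr1.
Qed.

Lemma gramX_weight i j n m : adj (T i ^+ n * T j ^+ m) * (T i ^+ n * T j ^+ m) =
  weight i j n m.
Proof. by rewrite -{2}dual2_weight mulrA adjT_dual2 mul1r. Qed.

(** Otherwise [|T_i^n x|^2 = |x|^2 + n <B_i x, x>] would become negative. *)
Lemma defect_ge0 i x : 0 <= Rez (ip (B i x) x).
Proof.
rewrite -oppr_le0; apply: (@nat_mul_bounded _ _ (rnorm x ^+ 2)) => n.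
have := gramX_weight i i n 0; rewrite expr0 mulr1 => h.
have := sqr_ge0 (rnorm ((T i ^+ n) x)).
rewrite rnorm_sq_adj h /weight mulr0n addr0 bopDE bopMnE ipDl ReD ipMnl ReMn ip_sq /=.
by lra.
Qed.

(** With [x = Q_i y], the claim is [<Q_i y, y> <= |Q_i y|^2], which holds as
    [Q_i = 1 + B_i] with [B_i >= 0]. *)
Lemma rnorm_dual i x : rnorm (S i x) <= rnorm x.
Proof.
rewrite -(@ler_pXn2r _ 2) ?nnegrE ?rnorm_ge0 //.
have -> : S i x = T i (V i x) by rewrite dualE.
have -> : rnorm x = rnorm (V i x + B i (V i x)).
  congr rnorm; rewrite -[V i x in X in X + _]bop1E -bopDE defectE addrC subrK.
  by rewrite -bopME gramV.
set y := V i x; rewrite rnormD2.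
have -> : rnorm (T i y) ^+ 2 = rnorm y ^+ 2 + Rez (ip (B i y) y).
  rewrite rnorm_sq_adj -gramE -[Q i](subrK 1) -defectE bopDE ipDl ReD ip_sq /=.
  by rewrite addrC.
have := defect_ge0 i y; have := sqr_ge0 (rnorm (B i y)).
by rewrite [ip y _]ipC ReJ; lra.
Qed.

Lemma range_projT_comm i j : i != j -> P i * T j = T j * P i.
Proof.
move=> ij; rewrite range_projEl mulrA -(Tcomm i j) -!mulrA -!left_inv_opE.
by rewrite Tlic.
Qed.

Lemma range_proj_gram i j : P i * Q j = Q j * P i.
Proof.
have [<-|ij] := eqVneq i j.
  have e : P i * Q i = P i * Q i * P i.
    have := congr1 (fun X => S i * X) (adjT_gram_proj i).
    by rewrite /= !mulrA -range_projE.
  by rewrite e; have := congr1 adj e; rewrite !adjM adj_gram adj_range_proj mulrA.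
have e := range_projT_comm ij.
by rewrite gramE mulrA; have := commr_adj e; rewrite adj_range_proj => ->; rewrite -!mulrA e.
Qed.
Lemma range_proj_V i j : P i * V j = V j * P i.
Proof.
rewrite -[P i * _]mul1r -(Vgram j) -mulrA (mulrA (Q j)) -range_proj_gram.
by rewrite -(mulrA _ (Q j)) gramV mulr1.
Qed.

Definition commutator i j := B i * B j - B j * B i.

Lemma defectTX i j n : B j * T i ^+ n = S i ^+ n * B j.
Proof.
elim: n => [|n IH]; first by rewrite !expr0 mulr1 mul1r.
by rewrite !exprS mulrA defectT -mulrA IH mulrA.
Qed.

Definition weight_inv1 i n := locked (adj (S i ^+ n) * S i ^+ n).
Lemma weight_inv1_gram i n : weight_inv1 i n = adj (S i ^+ n) * S i ^+ n.
Proof. by rewrite /weight_inv1 -lock. Qed.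
Definition weight1 i n := 1 + B i *+ n.

Lemma weight1E i n : weight1 i n = weight i i n 0.
Proof. by rewrite /weight mulr0n addr0. Qed.
Lemma weight_inv1E i n : weight_inv1 i n = weight_inv i i n 0.
Proof. by rewrite weight_inv1_gram /weight_inv expr0 mulr1. Qed.
Lemma weight1V i n : weight1 i n * weight_inv1 i n = 1.
Proof. by rewrite weight1E weight_inv1E weightV. Qed.
Lemma Vweight1 i n : weight_inv1 i n * weight1 i n = 1.
Proof. by rewrite weight1E weight_inv1E Vweight. Qed.
Lemma dualX_weight_inv1 i n : S i ^+ n = T i ^+ n * weight_inv1 i n.
Proof.
have := dual2_weight i i n 0; rewrite expr0 !mulr1 -weight1E => <-.
by rewrite -mulrA weight1V mulr1.
Qed.

Lemma defect_dualX i j n : B j * S i ^+ n = S i ^+ n * B j * weight_inv1 i n.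
Proof. by rewrite {1}dualX_weight_inv1 mulrA defectTX. Qed.

Lemma defect_weight_inv1 i n : B i *+ n * weight_inv1 i n = 1 - weight_inv1 i n.
Proof.
apply/eqP; rewrite eq_sym subr_eq -{2}[weight_inv1 i n]mul1r -mulrDl addrC.
by rewrite -[1 + _]/(weight1 i n) weight1V.
Qed.
Lemma weight_inv1_defect i n : weight_inv1 i n * (B i *+ n) = 1 - weight_inv1 i n.
Proof.
apply/eqP; rewrite eq_sym subr_eq -{2}[weight_inv1 i n]mulr1 -mulrDr addrC.
by rewrite -[1 + _]/(weight1 i n) Vweight1.
Qed.

(** The right-hand side is bounded in [n], as [S i] and [weight_inv1 i n] are
    contractions. *)
Lemma commutator_TX i j n : (commutator i j * T i ^+ n) *+ n =
  S i ^+ n * (B j * weight_inv1 i n - weight_inv1 i n * B j).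
Proof.
have d1 : B i * B j * T i ^+ n = S i ^+ n * (B i * weight_inv1 i n * B j).
  by rewrite -mulrA defectTX mulrA defect_dualX !mulrA.
have d2 : B j * B i * T i ^+ n = S i ^+ n * (B j * weight_inv1 i n * B i).
  by rewrite -mulrA defectTX mulrA defect_dualX !mulrA.
rewrite /commutator mulrBl d1 d2 -mulrBr -mulrnAr mulrnBl; congr (_ * _).
rewrite -!mulrnAl defect_weight_inv1 -mulrA mulrnAl -mulrnAr -mulrnAr weight_inv1_defect.
by rewrite mulrBl mul1r mulrBr mulr1 opprB addrC subrKA.
Qed.

Lemma weight11 i : weight1 i 1 = Q i.
Proof. by rewrite /weight1 mulr1n defectE addrC subrK. Qed.
Lemma weight_inv11 i : weight_inv1 i 1 = V i.
Proof. by rewrite -[LHS]mul1r -(Vgram i) -mulrA -weight11 weight1V mulr1. Qed.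

(** The case [n = 1] of [commutator_TX]: as [V i] is the inverse of [1 + B i], the
    bracket there is [V i] times the commutator times [V i]. *)
Lemma commutator_T i j : commutator i j * T i = S i * (V i * (commutator i j * V i)).
Proof.
have := commutator_TX i j 1; rewrite mulr1n !expr1 weight_inv11 => ->; congr (_ * _).
have a := defect_weight_inv1 i 1; have b := weight_inv1_defect i 1.
rewrite weight_inv11 mulr1n in a; rewrite weight_inv11 mulr1n in b.
rewrite /commutator mulrBl mulrBr -(mulrA (B j)) a !mulrA b.
rewrite mulrBl mul1r mulrBl mulrBr mulr1 opprB addrA.
by rewrite subrK.
Qed.

(** The kernels of the powers of [adj (T i)] are invariant under the inverse of
    [Q i]. *)
Lemma adjTX_V i n : exists X, adj (T i) ^+ n * V i = X * adj (T i) ^+ n.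
Proof.
(* [adj (T i) ^+ n * Q i = weight1 i n.+1 * adj (S i ^+ n)] by [dualX_weight], and
   [adj (S i ^+ n) = weight_inv1 i n * adj (T i) ^+ n]; solve for
   [adj (T i) ^+ n * V i]. *)
exists (weight1 i n * weight_inv1 i n.+1).
have e : adj (S i ^+ n) = weight_inv1 i n * adj (T i) ^+ n.
  by rewrite {1}dualX_weight_inv1 adjM adjX weight_inv1_gram adjM adjK.
have := congr1 adj (dualX_weight i i n 1 0).
rewrite -!weight1E !adjM weight11 adj_gram weight1E adj_weight -weight1E addn1 e adjX => h.
have := congr1 (fun X => weight1 i n * weight_inv1 i n.+1 * X * V i) h.
rewrite /= !mulrA -(mulrA (weight1 i n) (weight_inv1 i n.+1) (weight1 i n.+1)) Vweight1 mulr1.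
by rewrite weight1V mul1r => ->; rewrite -!mulrA gramV mulr1.
Qed.

Lemma range_projX i n : T i ^+ n * adj (S i ^+ n) = S i ^+ n * adj (T i) ^+ n.
Proof.
have -> : adj (S i ^+ n) = weight_inv1 i n * adj (T i) ^+ n.
  by rewrite {1}dualX_weight_inv1 // adjM adjX weight_inv1_gram adjM adjK.
by rewrite mulrA -dualX_weight_inv1.
Qed.

Lemma range_projX_adj i n :
  adj (S i ^+ n * adj (T i) ^+ n) = S i ^+ n * adj (T i) ^+ n.
Proof. by rewrite adjM adjX adjK range_projX. Qed.

(** Vanishing of the commutator propagates from [ker (adj (T i))] to the kernel of
    every power of [adj (T i)] by [commutator_T].  The kernel of [(adj (T i))^n]
    is complementary to the range of [T i ^+ n], where the norm of the commutator
    is [O(1/n)] by [commutator_TX].  All this happens within the kernel of an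
    operator [Pc] that commutes with [T i], so that the two variables can be
    treated in turn. *)
Lemma commutator_vanish i j Pc :
  Pc * T i = T i * Pc -> adj Pc = Pc -> Pc * V i = V i * Pc ->
  (forall z, Pc z = 0 -> adj (T i) z = 0 -> commutator i j z = 0) ->
  forall z, Pc z = 0 -> commutator i j z = 0.
Proof.
move=> PT Pa PV h0.
have PT' : Pc * adj (T i) = adj (T i) * Pc.
  by have := commr_adj PT; rewrite Pa.
have PS : Pc * S i = S i * Pc by rewrite dualE mulrA PT -!mulrA PV.
have levels n : forall z, Pc z = 0 -> (adj (T i) ^+ n) z = 0 -> commutator i j z = 0.
  elim: n => [|n IH] z Pz Tz; first by rewrite expr0 bop1E in Tz; rewrite Tz linear0.
  (* By [commutator_T], the value of the commutator at [T i (adj (S i) z)] is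
     determined by its value at [w], which lies one level lower. *)
  pose w := V i (V i (adj (T i) z)).
  have Pw : Pc w = 0.
    rewrite /w -!bopME PV -!mulrA (mulrA Pc) PV -!mulrA PT' !mulrA.
    by rewrite bopME Pz linear0.
  have Tw : (adj (T i) ^+ n) w = 0.
    have [X hX] := adjTX_V i n.
    have E : adj (T i) ^+ n * (V i * (V i * adj (T i))) =
             X * (X * adj (T i) ^+ n.+1).
      by rewrite mulrA hX -mulrA (mulrA _ (V i)) hX -mulrA -exprSr.
    rewrite -[LHS]/((adj (T i) ^+ n * (V i * (V i * adj (T i)))) z) E.
    by rewrite !bopME Tz !linear0.
  have -> : z = (1 - P i) z + T i (adj (S i) z).
    by rewrite -bopME -range_projEl -bopDE subrK.
  rewrite linearD.
  have -> : commutator i j (T i (adj (S i) z)) = 0.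
    rewrite -[LHS]/((commutator i j * T i) (adj (S i) z)) commutator_T adj_dualE.
    by rewrite -[LHS]/(S i (V i (commutator i j w))) IH // !linear0.
  have PP : Pc * P i = P i * Pc by rewrite range_projE mulrA PS -!mulrA PT'.
  rewrite addr0 h0 //.
    rewrite -[LHS]/((Pc * (1 - P i)) z) mulrBr mulr1 PP.
    by rewrite -{1}[Pc]mul1r -mulrBl bopME Pz linear0.
  rewrite -[LHS]/((adj (T i) * (1 - P i)) z).
  by rewrite mulrBr mulr1 adjT_range_proj subrr.
move=> z Pz; apply: rnorm0_eq0; apply/eqP; rewrite eq_le rnorm_ge0 andbT.
have [M M0 hM] := bop_bounded (B j).
apply: (@nat_mul_bounded _ _ (M * rnorm z + M * rnorm z)) => n.
have PX := range_projX i n.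
have PTX : Pc * T i ^+ n = T i ^+ n * Pc by apply: commrX.
have PTX' : Pc * adj (T i) ^+ n = adj (T i) ^+ n * Pc by apply: commrX.
have PSX : Pc * S i ^+ n = S i ^+ n * Pc by apply: commrX.
have -> : commutator i j z = (commutator i j * T i ^+ n) (adj (S i ^+ n) z).
  have h : commutator i j ((1 - S i ^+ n * adj (T i) ^+ n) z) = 0.
    apply: (levels n).
      rewrite -[LHS]/((Pc * (1 - S i ^+ n * adj (T i) ^+ n)) z) mulrBr mulr1.
      rewrite mulrA PSX -mulrA PTX' mulrA -{1}[Pc]mul1r -mulrBl.
      by rewrite bopME Pz linear0.
    rewrite -[LHS]/((adj (T i) ^+ n * (1 - S i ^+ n * adj (T i) ^+ n)) z).
    by rewrite mulrBr mulr1 mulrA adjT_dualX mul1r subrr.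
  apply/eqP; rewrite bopME -subr_eq0 -linearB -h -PX.
  by apply/eqP.
set y := adj (S i ^+ n) z.
have yz : rnorm y <= rnorm z by apply/contractive_adj/contractiveX/rnorm_dual.
have -> : n%:R * rnorm ((commutator i j * T i ^+ n) y) =
    rnorm ((commutator i j * T i ^+ n *+ n) y).
  by rewrite bopMnE rnormMn.
rewrite commutator_TX bopME.
have G y' : rnorm (weight_inv1 i n y') <= rnorm y'.
  rewrite weight_inv1_gram bopME; apply: (le_trans (contractive_adj _ _)); last first.
    exact/contractiveX/rnorm_dual.
  exact/contractiveX/rnorm_dual.
apply: le_trans (contractiveX _ _ _) _; first exact: rnorm_dual.
rewrite bopDE bopNE !bopME; apply: le_trans (rnormD _ _) _; rewrite rnormN.
apply: lerD.
  by apply: le_trans (hM _) _; rewrite ler_wpM2l //; apply: le_trans (G _) yz.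
apply: le_trans (G _) _; apply: le_trans (hM _) _; by rewrite ler_wpM2l.
Qed.

(** [commutator_vanish] is used twice: in the variable [i] within
    [ker (adj (T j))], and then in the variable [j] on the whole space. *)
Lemma defect_commute i j : i != j ->
  (forall z, adj (T i) z = 0 -> adj (T j) z = 0 -> Q i (Q j z) = Q j (Q i z)) ->
  B i * B j = B j * B i.
Proof.
move=> ij hE.
have ker k z : P k z = 0 -> adj (T k) z = 0.
  by move=> Pz; rewrite -adjT_range_proj bopME Pz linear0.
have ker' k z : adj (T k) z = 0 -> P k z = 0.
  by move=> Tz; rewrite range_projE bopME Tz linear0.
have commE z : commutator i j z = Q i (Q j z) - Q j (Q i z).
  rewrite /commutator !defectE !mulrBl !mul1r !mulrBr !mulr1.
  have -> : Q i * Q j - Q i - (Q j - 1) - (Q j * Q i - Q j - (Q i - 1)) =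
     Q i * Q j - Q j * Q i.
    have h (x a b : 'B(H)) : x - a - (b - 1) = x - (a + b - 1).
      by rewrite -addrA -opprD addrA.
    rewrite !h [Q j + Q i]addrC; move: (Q i + Q j - 1) => k.
    by rewrite opprB subrKA.
  by rewrite bopDE bopNE !bopME.
have onPj z : P j z = 0 -> commutator i j z = 0.
  apply: commutator_vanish; [by apply: range_projT_comm; rewrite eq_sym
    |exact: adj_range_proj
    |exact: range_proj_V|].
  by move=> y Pj Ti; rewrite commE hE ?subrr //; apply: ker.
have all0 z : commutator j i z = 0.
  apply: (@commutator_vanish j i 0); rewrite ?mul0r ?mulr0 ?adj0 // => y _ Tj.
  have -> : commutator j i = - commutator i j by rewrite /commutator opprB.
  by rewrite bopNE onPj ?oppr0 //; apply: ker'.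
by apply/esym/eqP; rewrite -subr_eq0; apply/eqP/bopP => z; apply: all0.
Qed.

Lemma expansive i (x : H) : rnorm x <= rnorm (T i x).
Proof.
rewrite -(@ler_pXn2r _ 2) ?nnegrE ?rnorm_ge0 // rnorm_sq_adj -gramE.
have -> : Q i = 1 + B i by rewrite defectE addrC subrK.
by rewrite bopDE ipDl ReD ip_sq /= lerDl defect_ge0.
Qed.

Lemma modulus_sqr i : modulus (T i) * modulus (T i) = Q i.
Proof. by rewrite gramE; case: (modulus_sqr_comm (expansive i)). Qed.

(** [P j] commutes with [Q i], hence with its square root. *)
Lemma modulus_range_proj i j :
  P j * modulus (T i) = modulus (T i) * P j.
Proof.
have [_ h] := modulus_sqr_comm (expansive i); apply: h.
by rewrite -gramE range_proj_gram.
Qed.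

Lemma modulus_ker i j z : adj (T j) z = 0 -> adj (T j) (modulus (T i) z) = 0.
Proof.
move=> Tz; rewrite -(adjT_range_proj j).
rewrite -[LHS]/((adj (T j) * (P j * modulus (T i))) z).
by rewrite modulus_range_proj range_projE // !bopME Tz !linear0.
Qed.

(** The moduli preserve the joint kernel, so that their commutation can be applied
    repeatedly. *)
Lemma gram_commute_of_moduli i j :
  (forall f, adj (T i) f = 0 -> adj (T j) f = 0 ->
    modulus (T i) (modulus (T j) f) = modulus (T j) (modulus (T i) f)) ->
  forall f, adj (T i) f = 0 -> adj (T j) f = 0 ->
    Q i (Q j f) = Q j (Q i f).
Proof.
move=> h f fi fj; rewrite -!modulus_sqr !bopME.
set A := modulus (T i) in h *; set B := modulus (T j) in h *.
have kA z : adj (T i) z = 0 /\ adj (T j) z = 0 ->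
    adj (T i) (A z) = 0 /\ adj (T j) (A z) = 0.
  by case=> *; split; apply: modulus_ker.
have kB z : adj (T i) z = 0 /\ adj (T j) z = 0 ->
    adj (T i) (B z) = 0 /\ adj (T j) (B z) = 0.
  by case=> *; split; apply: modulus_ker.
have h' z : adj (T i) z = 0 /\ adj (T j) z = 0 -> A (B z) = B (A z).
  by case=> *; apply: h.
have kf : adj (T i) f = 0 /\ adj (T j) f = 0 by [].
by rewrite (h' (B f)) ?(h' f) ?(h' (B (A f))) ?(h' (A f)) //; do ?[apply: kA|apply: kB].
Qed.

Section Positivity.
Variables i j : 'I_2.
Hypothesis ij : i != j.
Hypothesis Bcomm : B i * B j = B j * B i.

Lemma weight_comm n m n' m' : weight i j n m * weight i j n' m' =
  weight i j n' m' * weight i j n m.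
Proof.
have BB k l : B k * B l = B l * B k.
  have e u : u = i \/ u = j.
    move: (ij); case: u i j => [[|[|?]] ?] [[|[|?]] ?] [[|[|?]] ?] //;
    by move=> _; (left; exact: val_inj) || (right; exact: val_inj).
  by case: (e k) => ->; case: (e l) => ->; rewrite ?Bcomm.
rewrite /weight; apply: commrD; first apply: commrD; first exact: commr1;
  apply: commrMn; apply: commr_sym; (apply: commrD; first apply: commrD);
  first [exact: commr1 | apply: commrMn; apply: BB].
Qed.

Lemma weight_ge0 n m x : 0 <= ip (weight i j n m x) x.
Proof.
rewrite selfadjoint_real ?adj_weight // lecR /weight !bopDE !bopMnE !ipDl !ipMnl !ReD !ReMn.
rewrite ip_sq /= !addr_ge0 ?sqr_ge0 // mulr_ge0 // defect_ge0 //.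
Qed.

(** Two reductions to a kernel in the sum of the degrees, first in the variable [i]
    and then in [j], lead to the Gram operators of [S^(n,m)], the inverses of the
    weights, which form a Cauchy kernel. *)
Lemma bram_psd (r : seq (nat * nat)) (h : nat * nat -> H) :
  0 <= \sum_(p <- r) \sum_(q <- r)
    ip ((S i ^+ p.1 * S j ^+ p.2) (h q)) ((S i ^+ q.1 * S j ^+ q.2) (h p)).
Proof.
have SC k l : S k * S l = S l * S k by apply: dual_commute.
have SXC k l n m : S k ^+ n * S l ^+ m = S l ^+ m * S k ^+ n.
  by apply: commrX; apply/commr_sym/commrX.
have TC k l n : k != l -> S k ^+ n * adj (T l) = adj (T l) * S k ^+ n.
  by move=> kl; apply/esym/commrX; apply: adjT_dualC.
have bnd (f : nat * nat -> nat) p : p \in r -> (f p <= \sum_(q <- r) f q)%N.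
  by move=> pr; rewrite (big_rem p) //= leq_addr.
pose Z1 (p q : nat * nat) := S j ^+ p.2.
pose W1 (p q : nat * nat) := S j ^+ q.2.
have ji : j != i by rewrite eq_sym.
have SXE k l n m x : (S k ^+ n) ((S l ^+ m) x) = (S l ^+ m) ((S k ^+ n) x).
  by rewrite -!bopME SXC.
have -> : \sum_(p <- r) \sum_(q <- r)
    ip ((S i ^+ p.1 * S j ^+ p.2) (h q)) ((S i ^+ q.1 * S j ^+ q.2) (h p)) =
    split_form (S i) Z1 W1 r (fun p => p.1) 0 h h.
  by apply: eq_bigr => p _; apply: eq_bigr => q _; rewrite !addn0.
apply: (@split_form_ge0 _ _ _ _ (adj (T i)) _ _ _ _ _ _ _ _ _ _ (\sum_(q <- r) q.1)).
- exact: adjT_dual.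
- exact: range_projX_adj.
- by move=> p q; apply/esym/commrX/SC.
- by move=> p q; apply: TC.
- by move=> p q; apply/esym/commrX/SC.
- by move=> p q; apply: TC.
- move=> n m v; pose Z2 (p q : nat * nat) := S i ^+ (n p + n q + m).
  have -> : joint_form (S i) Z1 W1 r n m v =
      split_form (S j) Z2 Z2 r (fun p => p.2) 0 v v.
    apply: eq_bigr => p _; apply: eq_bigr => q _.
    by rewrite !addn0; congr (ip _ _); rewrite !bopME; apply: SXE.
  apply: (@split_form_ge0 _ _ _ _ (adj (T j)) _ _ _ _ _ _ _ _ _ _ (\sum_(q <- r) q.2)).
  + exact: adjT_dual.
  + exact: range_projX_adj.
  + by move=> p q; apply/esym/commrX/SC.
  + by move=> p q; apply: TC.
  + by move=> p q; apply/esym/commrX/SC.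
  + by move=> p q; apply: TC.
  + move=> n' m' w.
    have -> : joint_form (S j) Z2 Z2 r n' m' w = \sum_(p <- r) \sum_(q <- r)
        ip (weight_inv i j (n p + n q + m) (n' p + n' q + m') (w q)) (w p).
      apply: eq_bigr => p _; apply: eq_bigr => q _.
      by rewrite /weight_inv bopME adjPl !bopME !(SXE j i).
    apply: (@cauchy_psd _ _ _
      (fun p q => weight i j (n p + n q + m) (n' p + n' q + m'))) => *.
    * exact: weight_comm.
    * rewrite /weight [RHS]addrACA (addrACA 1) -!mulrnDr !mulrnDl -!mulrnA -mulr2n.
      by congr (_ + _ *+ _ + _ *+ _); ring.
    * exact: adj_weight.
    * exact: weight_ge0.
    * exact: Vweight.
    * exact: weightV.
  + by move=> p; apply: (bnd (fun p => p.2)).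
- by move=> p; apply: (bnd (fun p => p.1)).
Qed.
End Positivity.
End Pair.

Theorem corollary1 (R : realType) (H : hilbertType R) (T : 'I_2 -> 'B(H))
    (hcomm : commuting_pair T)
    (hlic : left_inverse_commuting T)
    (htoral : toral_2_isometry T)
    (hker : forall i, (adj (T i) * T i) @` ker_op (adj (T i)) `<=` ker_op (adj (T i)))
    (hmod : forall f : H,
       f \in ker_op (adj (T ord0)) `&` ker_op (adj (T ord_max)) ->
       (modulus (T ord0) * modulus (T ord_max)) f =
       (modulus (T ord_max) * modulus (T ord0)) f) :
  [/\ commuting_pair (toral_cauchy_dual T),
      forall i, contractive_op (toral_cauchy_dual T i) &
      jointly_subnormal (toral_cauchy_dual T)].
Proof.
have [_ Tlinv Tlic] := hlic; have [_ Ttoral] := htoral.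
have Tcomm i j : T i * T j = T j * T i.
  by rewrite (ord2P i) (ord2P j); case: ifP; case: ifP.
have dE i : toral_cauchy_dual T i = dual T i.
  by rewrite dualE gram_invE gramE.
have SC i j : toral_cauchy_dual T i * toral_cauchy_dual T j =
    toral_cauchy_dual T j * toral_cauchy_dual T i.
  by rewrite !dE; apply: dual_commute.
have Sle i x : rnorm (toral_cauchy_dual T i x) <= rnorm x by rewrite dE rnorm_dual.
have Bcomm : defect T ord0 * defect T ord_max = defect T ord_max * defect T ord0.
  apply: defect_commute => //; apply: gram_commute_of_moduli => //.
  by move=> f f0 f1; apply: hmod; rewrite inE.
split; first exact: SC.
  by move=> i x; rewrite !rnormE lecR.
apply: Bram_Halmos => // r h; rewrite /monomial !dE.
by apply: bram_psd.
Qed.
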